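(* Suppose $B$ is a non-scattered totally imperfect separable metrizable space and let $\kappa=\max(\omega_1,|B|)$. Then: (1) $\lambda\times\omega^\omega\le_T \mathcal{K}(B)\le_T ([\kappa]^{<\omega})^{\omega}$ for all cardinals $\lambda\le\kappa$; and (2) if $\kappa=\aleph_n$ for some $n\in\omega$, then $\omega_m\times\omega^\omega\le_T\mathcal{K}(B)\le_T \omega^\omega\times[\kappa]^{<\omega}$ for all $m\le n$; in particular, $\omega_1\times\omega^\omega\le_T\mathcal{K}(\mathbb{Q})\le_T\omega^\omega\times[\omega_1]^{<\omega}$.
   Context: A directed set is a (nonempty) partially ordered set in which every finite subset has an upper bound. For directed sets $P,Q$, write $P\ge_T Q$ (equivalently $Q\le_T P$) if there is a map $\phi:P\to Q$ carrying every cofinal subset of $P$ to a cofinal subset of $Q$ (a Tukey quotient). For a space $X$, $\mathcal{K}(X)$ is the set of compact subsets of $X$ ordered by inclusion. A (nonzero) cardinal is regarded as a directed set with its well-order; $\omega^\omega$ has the everywhere-domination (coordinatewise) order; $[\kappa]^{<\omega}$ is the set of finite subsets of $\kappa$ ordered by inclusion; products and powers of directed sets carry the coordinatewise order. A separable metrizable space is totally imperfect if it contains no homeomorphic copy of the Cantor set. A space $X$ is scattered if the transfinite process of successively removing isolated points (setting $X^{(0)}=X$, and $X^{(\alpha)}=X\setminus\bigcup_{\beta<\alpha}\{\text{isolated points of }X^{(\beta)}\}$) reaches $X^{(\alpha)}=\emptyset$ for some ordinal $\alpha$. $\mathbb{Q}$ is the space of rationals. *)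

(* Defs.v *)
(* MathComp / MathComp-Analysis development. *)
From HB Require Import structures.
From mathcomp Require Import all_boot all_order all_algebra.
From mathcomp Require Import all_classical all_reals all_analysis.
From mathcomp Require wochoice.
Import Order.TTheory GRing.Theory Num.Theory.
Import numFieldNormedType.Exports.

Set Implicit Arguments.
Unset Strict Implicit.
Unset Printing Implicit Defensive.

Local Open Scope classical_set_scope.
Local Open Scope card_scope.

(* [dle_ub] applied to the empty set makes the carrier nonempty. *)
Record directedSet := DirectedSet {
  dset :> Type;
  dle : dset -> dset -> Prop;
  dle_refl : forall x, dle x x;
  dle_anti : forall x y, dle x y -> dle y x -> x = y;
  dle_trans : forall y x z, dle x y -> dle y z -> dle x z;
  dle_ub : forall A : set dset, finite_set A -> exists u, forall x, A x -> dle x u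
}.

Definition cofinal (P : directedSet) (C : set P) : Prop :=
  forall x : P, exists2 c, C c & dle x c.

Definition tukey_le (Q P : directedSet) : Prop :=
  exists phi : P -> Q, forall C : set P, cofinal C -> cofinal (phi @` C).

Notation "Q '<=T' P" := (tukey_le Q P) (at level 70, no associativity).

Lemma finite_ub (T : Type) (le : T -> T -> Prop) :
  (forall y x z, le x y -> le y z -> le x z) -> [set: T] !=set0 ->
  (forall x y, exists u, le x u /\ le y u) ->
  forall A : set T, finite_set A -> exists u, forall x, A x -> le x u.
Proof.
move=> tr [t _] ub2 A /(@finite_seqP {classic T})[s ->].
elim: s => [|a s [u us]]; first by exists t.
have [v [av uv]] := ub2 a u; exists v => x /=; rewrite inE => /orP[/eqP->//|xs].
by apply: tr uv; exact: us.
Qed.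

Section products.
Variables P Q : directedSet.

Let le (x y : P * Q) := dle x.1 y.1 /\ dle x.2 y.2.

Let le_refl x : le x x. Proof. by split; exact: dle_refl. Qed.

Let le_anti x y : le x y -> le y x -> x = y.
Proof.
case: x y => [x1 x2] [y1 y2] [/= h1 h2] [/= k1 k2].
by rewrite (dle_anti h1 k1) (dle_anti h2 k2).
Qed.

Let le_trans y x z : le x y -> le y z -> le x z.
Proof. by case=> h1 h2 [k1 k2]; split; [exact: dle_trans k1|exact: dle_trans k2]. Qed.

Let le_ub (A : set (P * Q)) : finite_set A -> exists u, forall x, A x -> le x u.
Proof.
move=> fA.
have [u hu] := dle_ub (finite_image fst fA).
have [v hv] := dle_ub (finite_image snd fA).
by exists (u, v) => x Ax; split; [apply: hu; exists x|apply: hv; exists x].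
Qed.

Definition prodD := DirectedSet le_refl le_anti le_trans le_ub.

End products.

Section powers.
Variables (I : Type) (P : directedSet).

Let le (x y : I -> P) := forall i, dle (x i) (y i).

Let le_refl x : le x x. Proof. by move=> i; exact: dle_refl. Qed.

Let le_anti x y : le x y -> le y x -> x = y.
Proof. by move=> h k; apply/funext => i; exact: dle_anti. Qed.

Let le_trans y x z : le x y -> le y z -> le x z.
Proof. by move=> h k i; exact: dle_trans (k i). Qed.

Let le_ub (A : set (I -> P)) : finite_set A -> exists u, forall x, A x -> le x u.
Proof.
move=> fA.
have H i : exists u, forall x, A x -> dle (x i) u.
  have [u hu] := dle_ub (finite_image (fun x : I -> P => x i) fA).
  by exists u => x Ax; apply: hu; exists x.
by exists (fun i => projT1 (cid (H i))) => x Ax i; case: cid => u /=; apply.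
Qed.

Definition powD := DirectedSet le_refl le_anti le_trans le_ub.

End powers.

Section finite_subsets.
Variable T : Type.

Let car := {A : set T | finite_set A}.
Let le (A B : car) := sval A `<=` sval B.

Let le_refl A : le A A. Proof. by []. Qed.

Let le_anti A B : le A B -> le B A -> A = B.
Proof.
case: A B => [A pA] [B pB] h k.
by have e : A = B by [exact/seteqP]; case: _ / e pB {h k} => pB; rewrite (Prop_irrelevance pA pB).
Qed.

Let le_trans B A C : le A B -> le B C -> le A C.
Proof. exact: subset_trans. Qed.

Let le_ub (F : set car) : finite_set F -> exists u, forall x, F x -> le x u.
Proof.
apply: finite_ub => //; first by exists (exist _ set0 (finite_set0 T)).
move=> [A fA] [B fB].
by exists (exist _ (A `|` B) (eq_ind_r id (conj fA fB) (finite_setU A B))); split => x ?; [left|right].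
Qed.

Definition finD := DirectedSet le_refl le_anti le_trans le_ub.

End finite_subsets.

Section compact_sets.
Variable X : topologicalType.

Let car := {A : set X | compact A}.
Let le (A B : car) := sval A `<=` sval B.

Let le_refl A : le A A. Proof. by []. Qed.

Let le_anti A B : le A B -> le B A -> A = B.
Proof.
case: A B => [A pA] [B pB] h k.
by have e : A = B by [exact/seteqP]; case: _ / e pB {h k} => pB; rewrite (Prop_irrelevance pA pB).
Qed.

Let le_trans B A C : le A B -> le B C -> le A C.
Proof. exact: subset_trans. Qed.

Let le_ub (F : set car) : finite_set F -> exists u, forall x, F x -> le x u.
Proof.
apply: finite_ub => //; first by exists (exist _ set0 (@compact0 X)).
move=> [A cA] [B cB].
by exists (exist _ (A `|` B) (compactU cA cB)); split => x ?; [left|right].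
Qed.

Definition compactD := DirectedSet le_refl le_anti le_trans le_ub.

End compact_sets.

Section well_orders.
Variables (T : Type) (R : rel T).
Hypothesis Rwo : wochoice.well_order R.

Lemma wo_min (A : set T) : A !=set0 -> exists2 z, A z & forall x, A x -> R z x.
Proof.
move=> [a Aa].
have [z [[Az zA] _]] := @Rwo [pred x | `[< A x >]] (ex_intro _ a (asboolT Aa)).
exists z; first exact: asboolW Az.
by move=> x Ax; apply: zA; exact: asboolT.
Qed.

Lemma wo_total x y : R x y \/ R y x.
Proof.
have [|z [->|->] h] := @wo_min [set x; y]; first by exists x; left.
- by left; apply: h; right.
- by right; apply: h; left.
Qed.

Lemma wo_refl x : R x x.
Proof. by case: (wo_total x x). Qed.

Lemma wo_anti x y : R x y -> R y x -> x = y.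
Proof.
move=> xy yx.
have [z [_ uz]] := @Rwo [pred z | `[< z = x \/ z = y >]]
  (ex_intro _ x (asboolT (or_introl erefl))).
rewrite -(uz x) ?(uz y) //; split.
- by apply: asboolT; right.
- by move=> w /asboolW[->//|->]; exact: wo_refl.
- by apply: asboolT; left.
- by move=> w /asboolW[->|->//]; exact: wo_refl.
Qed.

Lemma wo_trans y x z : R x y -> R y z -> R x z.
Proof.
move=> xy yz.
have [|w hw h] := @wo_min [set t | [\/ t = x, t = y | t = z]].
  by exists x; constructor 1.
case: hw h => -> h; first by apply: h; constructor 3.
- have yx : R y x by apply: h; constructor 1.
  by rewrite (wo_anti xy yx).
- have zy : R z y by apply: h; constructor 2.
  by rewrite -(wo_anti yz zy).
Qed.

End well_orders.

Lemma wo_intro (T : Type) (R : rel T) :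
  (forall x y, R x y -> R y x -> x = y) ->
  (forall A : set T, A !=set0 -> exists2 z, A z & forall x, A x -> R z x) ->
  wochoice.well_order R.
Proof.
move=> anti h A [a Aa].
have [|z Az zA] := h [set x | x \in A]; first by exists a.
exists z; split; first by split=> // x; exact: zA.
by move=> y [Ay yA]; apply: anti; [exact: zA|exact: yA].
Qed.

Lemma wo_exists (T : Type) : exists R : rel T, wochoice.well_order R.
Proof. by have [R wR] := wochoice.well_ordering_principle {classic T}; exists R. Qed.

Lemma wo_pull (T U : Type) (R : rel T) (f : U -> T) :
  injective f -> wochoice.well_order R ->
  wochoice.well_order [rel x y | R (f x) (f y)].
Proof.
move=> finj Rwo; apply: wo_intro => [x y /= xy yx|A [a Aa]].
  by apply: finj; exact: (wo_anti Rwo).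
have [|_ [z Az <-] h] := @wo_min _ _ Rwo (f @` A); first by exists (f a), a.
by exists z => // x Ax; apply: h; exists x.
Qed.

Definition segment (T : Type) (R : rel T) (x : T) : set T :=
  [set y | R y x /\ y <> x].

(* Cardinals are initial ordinals: well-ordered sets that do not inject into
   any of their proper initial segments.  The empty cardinal is allowed. *)
Record cardinal := Cardinal {
  csort :> Type;
  cle : rel csort;
  cle_wo : wochoice.well_order cle;
  cle_initial : forall x, ~~ ([set: csort] #<= segment cle x)
}.

Lemma inj_le (T U : Type) (f : T -> U) (B : set U) :
  injective f -> (forall x, B (f x)) -> [set: T] #<= B.
Proof.
move=> finj fB.
have /card_eqPle[_] := @inj_card_eq _ _ [set: T] f (in2W finj).
by move=> /card_le_trans; apply; apply: subset_card_le => _ [x _ <-].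
Qed.

Lemma card_set_type (T : Type) (U : set T) : [set: U] #= U.
Proof.
have h : injective (set_val : U -> T) by move=> x y; exact: val_inj.
rewrite -(card_eql (@inj_card_eq _ _ [set: U] _ (in2W h))).
suff -> : range (set_val : U -> T) = U by [].
apply/seteqP; split=> [_ [[x xU] _ <-]|x Ux]; first exact: set_mem.
by exists (SigSub (mem_set Ux)).
Qed.

Lemma segment_set_type (T : Type) (R : rel T) (U : set T) (u : U) :
  segment [rel x y : U | R (set_val x) (set_val y)] u #<= segment R (set_val u).
Proof.
set S := segment _ _.
have h : injective (set_val : U -> T) by move=> x y; exact: val_inj.
have /card_eqPle[_] := @inj_card_eq _ _ S _ (in2W h).
move=> /card_le_trans; apply; apply: subset_card_le => _ [x [xu nxu] <-].
by split=> // /h.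
Qed.

Lemma cantor_lt (T : Type) : ~~ ([set: set T] #<= [set: T]).
Proof.
apply/negP => /(elimT card_leP)[g].
pose f (A : set T) : T := set_val (g (to_setT A)).
have finj : injective f.
  move=> A B /val_inj e.
  have := @inj _ _ _ g (to_setT A) (to_setT B).
  by rewrite !inE => /(_ I I e) /(congr1 val).
pose D := [set a | exists2 A, f A = a & ~ A a].
have [DfD|nDfD] := pselect (D (f D)).
  by have [A /finj ->] := DfD; apply.
by apply: (nDfD); exists D.
Qed.

Lemma card_of_exists (T : Type) : exists k : cardinal, [set: k] #= [set: T].
Proof.
have [R Rwo] := wo_exists T.
have [[x1 hx1]|nox] := pselect (exists x, [set: T] #<= segment R x); last first.
  have init x : ~~ ([set: T] #<= segment R x).
    by apply/negP => h; apply: nox; exists x.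
  by exists (Cardinal Rwo init).
have [|x0 Tx0 x0min] := @wo_min _ _ Rwo [set x | [set: T] #<= segment R x].
  by exists x1.
pose U := segment R x0.
have UT : [set: U] #= [set: T].
  by rewrite (card_eql (card_set_type U)) card_eq_le card_leT Tx0.
have vinj : injective (set_val : U -> T) by move=> x y; exact: val_inj.
have init u : ~~ ([set: U] #<= segment [rel x y : U | R (set_val x) (set_val y)] u).
  apply/negP; rewrite (card_le_eql UT) => h.
  have /x0min x0u := card_le_trans h (segment_set_type R u).
  have [ux0 nux0] : U (set_val u) by case: u {h x0u} => x xU; exact: set_mem.
  by apply: nux0; exact: (wo_anti Rwo).
by exists (Cardinal (wo_pull vinj Rwo) init).
Qed.

Definition card_of (T : Type) : cardinal := projT1 (cid (card_of_exists T)).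

Lemma card_ofE (T : Type) : [set: card_of T] #= [set: T].
Proof. exact: projT2 (cid (card_of_exists T)). Qed.

Lemma succ_card_exists (a : cardinal) : exists b : cardinal,
  ~~ ([set: b] #<= [set: a]) /\ forall x : b, segment (@cle b) x #<= [set: a].
Proof.
have [R Rwo] := wo_exists (set a).
pose U := [set x | segment R x #<= [set: a]].
have Ua : ~~ (U #<= [set: a]).
  apply/negP => Ua.
  have [UT|nUT] := pselect (U = setT).
    by move: (cantor_lt a); rewrite -UT Ua.
  have [y nUy] : exists y, ~ U y.
    by apply/existsNP => h; apply: nUT; apply/seteqP; split.
  have [|x0 nUx0 x0min] := @wo_min _ _ Rwo (~` U); first by exists y.
  apply: nUx0; apply: card_le_trans Ua; apply: subset_card_le => x [xx0 nxx0].
  by apply: contrapT => /x0min h; apply: nxx0; exact: (wo_anti Rwo).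
have vinj : injective (set_val : U -> set a) by move=> x y; exact: val_inj.
have seg (u : U) : segment [rel x y : U | R (set_val x) (set_val y)] u #<= [set: a].
  by apply: card_le_trans (segment_set_type R u) _; case: u => x xU; exact: set_mem xU.
have nU : ~~ ([set: U] #<= [set: a]) by rewrite (card_le_eql (card_set_type U)).
have init u : ~~ ([set: U] #<= segment [rel x y : U | R (set_val x) (set_val y)] u).
  by apply: contra nU => h; exact: card_le_trans h (seg u).
by exists (Cardinal (wo_pull vinj Rwo) init).
Qed.

(* $a^+$, as the least ordinal that does not inject into $a$ *)
Definition succ_card (a : cardinal) : cardinal := projT1 (cid (succ_card_exists a)).

Lemma succ_cardE (a : cardinal) :
  ~~ ([set: succ_card a] #<= [set: a]) /\
  forall x : succ_card a, segment (@cle (succ_card a)) x #<= [set: a].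
Proof. exact: projT2 (cid (succ_card_exists a)). Qed.

Lemma leq_wo : wochoice.well_order leq.
Proof.
apply: wo_intro => [x y xy yx|A [a Aa]]; first by apply/eqP; rewrite eqn_leq xy yx.
have ex : exists n, `[< A n >] by exists a; apply/asboolP.
exists (ex_minn ex); case: ex_minnP => n /asboolP // An h.
by move=> x Ax; apply: h; apply/asboolP.
Qed.

Lemma leq_initial (n : nat) : ~~ ([set: nat] #<= segment leq n).
Proof.
apply/negP => /infiniteP; apply.
by apply: sub_finite_set (finite_II n.+1) => m [mn _]; rewrite /mkset ltnS.
Qed.

Definition aleph0 : cardinal := Cardinal leq_wo leq_initial.

Definition aleph (n : nat) : cardinal := iter n succ_card aleph0.

Lemma aleph_neq0 (n : nat) : [set: aleph n] !=set0.
Proof.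
case: n => [|n]; first by exists 0%N.
apply/set0P/negP => /eqP e.
by have [/negP + _] := succ_cardE (aleph n); apply; rewrite /aleph /= e.
Qed.

Definition cardinal_max (a b : cardinal) : cardinal :=
  if [set: a] #<= [set: b] then b else a.

Section cardinal_directed.
Variables (a : cardinal) (a0 : [set: a] !=set0).

Let le_refl x : cle x x := wo_refl (@cle_wo a) x.
Let le_anti x y : cle x y -> cle y x -> x = y := @wo_anti _ _ (@cle_wo a) x y.
Let le_trans y x z : cle x y -> cle y z -> cle x z :=
  @wo_trans _ _ (@cle_wo a) y x z.

Let le_ub (A : set a) : finite_set A -> exists u, forall x, A x -> cle x u.
Proof.
apply: (finite_ub le_trans a0) => x y.
by have [h|h] := wo_total (@cle_wo a) x y; [exists y|exists x]; split.
Qed.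

Definition cardD := @DirectedSet a (@cle a) le_refl le_anti le_trans le_ub.

End cardinal_directed.

Definition omegaD (m : nat) : directedSet := cardD (aleph_neq0 m).

Definition baireD : directedSet := powD nat (omegaD 0).

Definition homeomorphic (X Y : topologicalType) : Prop :=
  exists (f : X -> Y) (g : Y -> X),
    [/\ cancel f g, cancel g f, continuous f & continuous g].

Definition metrizable (R : realType) (X : topologicalType) : Prop :=
  exists M : metricType R, homeomorphic X M.

Definition separable (X : topologicalType) : Prop :=
  exists2 D : set X, countable D & dense D.

(* A subset [A] used as a type carries the subspace topology. *)
Definition totally_imperfect (X : topologicalType) : Prop :=
  forall A : set X, ~ homeomorphic A cantor_space.

(* The derivatives $X^{(\alpha)}$ are indexed by the elements of a well-ordered
   type; the recursion determines [D], and every ordinal occurs as an element of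
   some well-order. *)
Definition scattered (X : topologicalType) : Prop :=
  exists (W : Type) (le : rel W) (D : W -> set X),
    [/\ wochoice.well_order le,
        forall a, D a = ~` \bigcup_(b in segment le a) isolated (D b)
      & exists a, D a = set0].

(* Main.v *)
(* Write K(B) for the compact subsets of B.  Since B contains no Cantor set, every
   compact K in B is scattered: removing from K the points near which K has
   already been dismantled must leave nothing, as what is left would be
   dense in itself, and a compact set with a nonempty dense-in-itself subset
   contains a Cantor set.  So K has a rank a < omega_1 and is countable.

   Upper bounds.  If K has rank a, there is a finite set G such that each
   K \ N_{1/(n+1)}(G) has rank below a.  Coding K by G and, recursively, by its
   countably many pieces gives a Tukey map on {K | rank K <= a}: compact bounds
   L_n for the pieces glue to the compact set of all y which, for every n, lie
   in N_{1/(n+1)}(G) or in L_n.  Taking the union over a < omega_1 costs a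
   factor [omega_1]^{<omega}.  For (2), the coding is done inside one countable
   set at a time, and aleph_n has a small family of countable sets cofinal
   among all of them.

   Lower bounds.  Let P be nonempty and dense in itself.  No ball of P has
   compact closure, so near p in P there are sequences s_n in the ball of
   radius 1/(n+1) meeting each compact set finitely often, and
   f |-> {p} u {s_n(f n)} embeds omega^omega.  A cardinal lambda with a
   countable cofinal subset lies below omega.  Otherwise all its countable
   subsets are bounded, and lambda is embedded by singletons if lambda <= |B|,
   or by compact sets of unboundedly large rank if lambda <= omega_1. *)
Require Import Defs.
From mathcomp Require Import all_boot all_order all_algebra.
From mathcomp Require Import all_classical all_reals all_analysis.
From mathcomp Require Import lra.
Import Order.TTheory GRing.Theory Num.Theory.
Import numFieldNormedType.Exports.

Set Implicit Arguments.
Unset Strict Implicit.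
Unset Printing Implicit Defensive.

Local Open Scope classical_set_scope.
Local Open Scope card_scope.

(** * Tukey maps and cardinals *)

Lemma card_le_injP (T U : Type) :
  [set: T] #<= [set: U] <-> exists f : T -> U, injective f.
Proof.
split=> [/(elimT card_leP)[g]|[f finj]]; last by apply: (@inj_le _ _ f).
exists (fun x => set_val (g (to_setT x))) => x y /val_inj e.
by have := @inj _ _ _ g (to_setT x) (to_setT y);
  rewrite !inE => /(_ I I e) /(congr1 val).
Qed.

Lemma countable_inj (T : Type) (A : set T) : countable A ->
  exists f : T -> nat, forall x y, A x -> A y -> f x = f y -> x = y.
Proof.
move=> /countable_injP[f finj]; exists f => x y Ax Ay.
by apply: finj; rewrite inE.
Qed.

Lemma inj_countable (T : Type) (A : set T) (f : T -> nat) :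
  (forall x y, A x -> A y -> f x = f y -> x = y) -> countable A.
Proof.
move=> finj; apply/countable_injP; exists f => x y.
by rewrite !inE; exact: finj.
Qed.

Lemma inj_countable_preimage (T U : Type) (f : T -> U) (A : set U) :
  injective f -> countable A -> countable (f @^-1` A).
Proof.
move=> finj /countable_inj[g ginj].
by apply: (@inj_countable _ _ (g \o f)) => x y Ax Ay /ginj-/(_ Ax Ay)/finj.
Qed.

Lemma inj_finite_preimage (T U : Type) (f : T -> U) (A : set U) :
  injective f -> finite_set A -> finite_set (f @^-1` A).
Proof. by move=> finj; apply: finite_preimage => x y _ _; exact: finj. Qed.

Section tukey.

(* A Galois--Tukey connection: the preimage of a bounded set is bounded. *)
Definition tukey_map (Q P : directedSet) : Prop := exists psi : Q -> P,
  forall p, exists q0, forall q, dle (psi q) p -> dle q q0.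

Lemma tukey_map_le (Q P : directedSet) : tukey_map Q P -> Q <=T P.
Proof.
move=> [psi /choice[phi h]]; exists phi => C cofC q.
have [c Cc qc] := cofC (psi q).
by exists (phi c); [exists c|exact: h].
Qed.

Lemma tukey_map_trans (P Q S : directedSet) :
  tukey_map S Q -> tukey_map Q P -> tukey_map S P.
Proof.
move=> [f fP] [g gP]; exists (g \o f) => p.
have [q hq] := gP p; have [s hs] := fP q.
by exists s => t /hq/hs.
Qed.

Lemma tukey_map_refl (P : directedSet) : tukey_map P P.
Proof. by exists id => p; exists p. Qed.

(** A pair goes to a common upper bound of its two images. Hence products are least upper bounds in
    the Tukey order. *)
Lemma tukey_map_prod (P Q1 Q2 : directedSet) :
  tukey_map Q1 P -> tukey_map Q2 P -> tukey_map (prodD Q1 Q2) P.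
Proof.
move=> [f fP] [g gP].
have /choice[ub ubP] : forall z : P * P, exists u, dle z.1 u /\ dle z.2 u.
  move=> [x y]; have [u hu] := dle_ub (finite_set2 x y).
  by exists u; split; apply: hu; [left|right].
exists (fun q => ub (f q.1, g q.2)) => p.
have [q1 h1] := fP p; have [q2 h2] := gP p.
exists (q1, q2) => -[x y] /= h; have [/= u1 u2] := ubP (f x, g y).
by split; [apply: h1; exact: dle_trans h|apply: h2; exact: dle_trans h].
Qed.

Lemma tukey_map_fst (P Q : directedSet) : tukey_map P (prodD P Q).
Proof.
have [q0 _] := @dle_ub Q set0 (finite_set0 _).
by exists (fun p => (p, q0)) => -[p q]; exists p => x [].
Qed.

Lemma tukey_map_snd (P Q : directedSet) : tukey_map Q (prodD P Q).
Proof.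
have [p0 _] := @dle_ub P set0 (finite_set0 _).
by exists (fun q => (p0, q)) => -[p q]; exists q => x [].
Qed.

Lemma tukey_map_proj (P : directedSet) : tukey_map P (powD nat P).
Proof. by exists (fun p _ => p) => p; exists (p 0%N) => q; exact. Qed.

Lemma tukey_map_pow_pow (P : directedSet) :
  tukey_map (powD nat (powD nat P)) (powD nat P).
Proof.
exists (fun q n => let z := odflt (0, 0)%N (unpickle n) in q z.1 z.2) => p.
exists (fun i j => p (pickle (i, j))) => q /= h i j.
by have := h (pickle (i, j)); rewrite pickleK.
Qed.

Lemma tukey_map_fin (T U : Type) (f : T -> U) : injective f ->
  tukey_map (finD T) (finD U).
Proof.
move=> finj.
exists (fun A => exist _ (f @` sval A) (finite_image f (svalP A))) => -[G fG].
exists (exist _ (f @^-1` G) (inj_finite_preimage finj fG)) => -[A fA] /= h x Ax.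
by apply: h; exists x.
Qed.

Lemma tukey_map_fin_prod (T U : Type) :
  tukey_map (finD (T * U)) (prodD (finD T) (finD U)).
Proof.
exists (fun A => (exist _ (fst @` sval A) (finite_image fst (svalP A)),
                  exist _ (snd @` sval A) (finite_image snd (svalP A)))).
move=> [[G fG] [H fH]]; exists (exist _ (G `*` H) (finite_setX fG fH)).
by move=> [A fA] /= [/= h k] x Ax; split; [apply: h|apply: k]; exists x.
Qed.

Lemma tukey_map_omega_fin (T : Type) : [set: nat] #<= [set: T] ->
  tukey_map (omegaD 0) (finD T).
Proof.
move=> /card_le_injP[j jinj].
exists (fun n => exist _ [set j n] (finite_set1 (j n))) => -[G fG].
have [n hn] := @dle_ub (omegaD 0) _ (inj_finite_preimage jinj fG).
by exists n => q h; apply: hn; exact: h.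
Qed.

End tukey.

(** * Comparison and products of cardinals *)

Section cardinals.

(** A maximal partial injection, given by its graph, is total or onto: two points missed on either
    side could be joined by one more pair. *)
Lemma card_le_total (T U : Type) :
  [set: T] #<= [set: U] \/ [set: U] #<= [set: T].
Proof.
pose pinj (G : set (T * U)) := forall z w, G z -> G w -> z.1 = w.1 <-> z.2 = w.2.
have [F Fpinj Ftot|G [Ginj Gmax]] := @Zorn_bigcup _ pinj.
  move=> z w [A FA Az] [B FB Bw].
  by have [AB|BA] := Ftot A B FA FB; [apply: (Fpinj B) => //; exact: AB|
    apply: (Fpinj A) => //; exact: BA].
have [hT|hT] := pselect (forall x, exists y, G (x, y)).
  left; have [f fG] := choice hT; apply/card_le_injP; exists f => x x' e.
  by have := Ginj _ _ (fG x) (fG x'); rewrite /= => ->.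
right; have [hU|hU] := pselect (forall y, exists x, G (x, y)).
  have [f fG] := choice hU; apply/card_le_injP; exists f => y y' e.
  by have := Ginj _ _ (fG y) (fG y'); rewrite /= => <-.
have [x hx] := (existsNP _).2 hT; have [y hy] := (existsNP _).2 hU.
exfalso; apply: (Gmax (G `|` [set (x, y)])).
  by split; [exact: subsetUl|move=> h; apply: hx; exists y; apply: h; right].
move=> [a b] [a' b'] [Gz|[-> ->]] [Gw|[-> ->]] //=.
- exact: Ginj Gz Gw.
- by split=> e; exfalso; [apply: hx; exists b; rewrite -e|
    apply: hy; exists a; rewrite -e].
- by split=> e; exfalso; [apply: hx; exists b'; rewrite e|
    apply: hy; exists a'; rewrite e].
Qed.

Lemma card_le_max (a b : cardinal) :
  [set: a] #<= [set: cardinal_max a b] /\ [set: b] #<= [set: cardinal_max a b].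
Proof.
rewrite /cardinal_max; case: ifPn => [//|/negP nab]; split => //.
by have [|//] := card_le_total a b.
Qed.

Lemma aleph_leS (n : nat) : [set: aleph n] #<= [set: aleph n.+1].
Proof.
have [/negP h _] := succ_cardE (aleph n).
by have [//|] := card_le_total (aleph n) (aleph n.+1).
Qed.

Lemma aleph_le (m n : nat) : (m <= n)%N -> [set: aleph m] #<= [set: aleph n].
Proof.
elim: n => [|n IH]; first by rewrite leqn0 => /eqP->.
rewrite leq_eqVlt ltnS => /orP[/eqP->//|/IH h].
exact: card_le_trans h (aleph_leS n).
Qed.

(* A maximal disjoint family of injections [nat -> T] covers all but finitely
   many points of [T]; the latter are absorbed by the even places of one member. *)
Lemma card_prod_nat (T : Type) : [set: nat] #<= [set: T] ->
  [set: T * nat] #<= [set: T].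
Proof.
move=> /card_le_injP[e0 e0inj].
pose dis (E : set (nat -> T)) := (forall e, E e -> injective e) /\
  (forall e f i j, E e -> E f -> e i = f j -> e = f).
have [F Fdis Ftot|E [[Einj Edis] Emax]] := @Zorn_bigcup _ dis.
  split=> [e [A FA]|e f i j [A FA Ae] [B FB Bf]]; first exact: (Fdis A FA).1.
  by have [AB|BA] := Ftot A B FA FB;
    [apply: (Fdis B FB).2 => //; exact: AB|apply: (Fdis A FA).2 => //; exact: BA].
pose U := [set x | exists e i, E e /\ e i = x].
have finU : finite_set (~` U).
  apply: contrapT => /infiniteP/card_leP[g].
  pose e n := set_val (g (to_setT n)).
  have eU n : ~ U (e n) by exact: set_mem (valP (g (to_setT n))).
  have einj : injective e.
    move=> x y /val_inj h; have := @inj _ _ _ g (to_setT x) (to_setT y).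
    by rewrite !inE => /(_ I I h) /(congr1 val).
  apply: (Emax (E `|` [set e])).
    split; first exact: subsetUl.
    by move=> h; apply: (eU 0%N); exists e, 0%N; split => //; apply: h; right.
  split=> [f [/Einj//|->//]|f h i j].
  move=> [Ef|->] [Eh|->] fh //; first exact: Edis fh.
    by case: (eU j); rewrite -fh; exists f, i.
  by case: (eU i); rewrite fh; exists h, j.
have [e1 Ee1] : E !=set0.
  apply/set0P/negP => /eqP EE; move: finU.
  have -> : ~` U = setT by apply/seteqP; split=> // x _ [e [i [+ _]]]; rewrite EE.
  by move=> /finite_setPn; apply; apply/card_le_injP; exists e0.
have [c cinj] := countable_inj (finite_set_countable finU).
have U_ (x : T) : exists z : (nat -> T) * nat, U x -> E z.1 /\ z.1 z.2 = x.
  have [[e [i Ee]]|nU] := pselect (U x); first by exists (e, i).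
  by exists (e1, 0%N).
have [r rP] := choice U_.
apply/card_le_injP.
(* A point of [U] is [e i] for a member [e] of [E]; its pair with [k] goes to an odd place of the
   same [e], which disjointness recovers. The finitely many other points, numbered by [c], use the
   even places of [e1]. *)
exists (fun z : T * nat => if pselect (U z.1) then (r z.1).1 (pickle ((r z.1).2, z.2)).*2.+1
                 else e1 (pickle (c z.1, z.2)).*2).
move=> [x k] [y l] /=; case: pselect => Ux; case: pselect => Uy.
- have [Ex ex] := rP _ Ux; have [Ey ey] := rP _ Uy => h.
  have ee := Edis _ _ _ _ Ex Ey h; move: h; rewrite ee => /(Einj _ Ey)[].
  by move=> /double_inj/(pcan_inj pickleK)[rr ->]; rewrite -ex -ey ee rr.
- have [Ex ex] := rP _ Ux => h.
  have ee := Edis _ _ _ _ Ex Ee1 h; move: h; rewrite ee => /(Einj _ Ee1).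
  by move=> /(congr1 odd); rewrite /= !odd_double.
- have [Ey ey] := rP _ Uy => h.
  have ee := Edis _ _ _ _ Ee1 Ey h; move: h; rewrite ee => /(Einj _ Ey).
  by move=> /(congr1 odd); rewrite /= !odd_double.
- by move=> /(Einj _ Ee1)/double_inj/(pcan_inj pickleK)[/cinj-> // ->].
Qed.

End cardinals.

Section well_orders.
Variables (T : Type) (R : rel T).
Hypothesis Rwo : wochoice.well_order R.

Lemma wo_ind (P : T -> Prop) :
  (forall x, (forall y, segment R x y -> P y) -> P x) -> forall x, P x.
Proof.
move=> h x; apply: contrapT => nPx.
have [|z nPz zmin] := @wo_min _ _ Rwo (~` P); first by exists x.
apply: nPz; apply: h => y [yz nyz]; apply: contrapT => /zmin zy.
exact: nyz (wo_anti Rwo yz zy).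
Qed.

Lemma segment_le_trans x y z : R y z -> segment R y x -> segment R z x.
Proof.
move=> yz [xy nxy]; split; first exact: (wo_trans Rwo) yz.
by move=> xz; rewrite xz in xy nxy; exact: nxy (wo_anti Rwo xy yz).
Qed.

Lemma nsegment_le x y : ~ segment R x y -> R x y.
Proof.
move=> h; have [//|yx] := wo_total Rwo x y.
have [->|nyx] := pselect (y = x); first exact: (wo_refl Rwo).
by case: h.
Qed.

End well_orders.

(** * Countable subsets of cardinals *)

Section cofinality.

Lemma card_le_inj_on (T U : Type) (u0 : U) (A : set T) : A #<= [set: U] ->
  exists f : T -> U, forall x y, A x -> A y -> f x = f y -> x = y.
Proof.
move=> /card_leP[g].
exists (fun x => if pselect (A x) is left Ax
                 then set_val (g (SigSub (mem_set Ax))) else u0) => x y Ax Ay.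
case: pselect => // Ax'; case: pselect => // Ay' /val_inj e.
by have := inj _ _ e; rewrite !inE => /(_ I I)/(congr1 val).
Qed.

Lemma finite_inj_bounded (T : Type) (A : set T) (c : T -> nat) (p : nat) :
  (forall x, A x -> (c x <= p)%N) ->
  (forall x y, A x -> A y -> c x = c y -> x = y) -> finite_set A.
Proof.
move=> cp cinj; rewrite -(@eq_finite_set _ _ (c @` A)).
  apply: sub_finite_set (finite_II p.+1) => _ [x Ax <-].
  by rewrite /mkset ltnS; exact: cp.
by apply: inj_card_eq => x y /set_mem Ax /set_mem Ay; exact: cinj.
Qed.

Lemma segment_aleph_inj (n : nat) : exists f : aleph n.+1 -> aleph n.+1 -> aleph n,
  forall u x y, segment (@cle (aleph n.+1)) u x ->
    segment (@cle (aleph n.+1)) u y -> f u x = f u y -> x = y.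
Proof.
have [a0 _] := aleph_neq0 n.
have /choice[f fP] u := card_le_inj_on a0 ((succ_cardE (aleph n)).2 u).
by exists f.
Qed.

Lemma card_nat_aleph (n : nat) : [set: nat] #<= [set: aleph n].
Proof. exact: (@aleph_le 0 n). Qed.

(** Otherwise every u is at most some [b u] in A, so the cardinal is a countable union of sets of
    size at most [aleph n], and injects into [aleph n] times [nat], hence into [aleph n]. *)
Lemma countable_aleph_bounded (n : nat) (A : set (aleph n.+1)) : countable A ->
  exists u, A `<=` segment (@cle (aleph n.+1)) u.
Proof.
move=> cA; apply: contrapT => nbd.
have [f finj] := segment_aleph_inj n; have [a0 _] := aleph_neq0 n.
have [c cinj] := countable_inj cA.
have /choice[b bP] : forall u, exists x, A x /\ cle u x.
  move=> u; apply: contrapT => h; apply: nbd; exists u => x Ax.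
  apply: contrapT => /(nsegment_le (@cle_wo _)) ux.
  by apply: h; exists x.
have [/negP + _] := succ_cardE (aleph n); apply.
apply: card_le_trans (card_prod_nat (card_nat_aleph n)).
apply/card_le_injP.
(* The code of u is its place in the segment below [b u], with the number of [b u]. An even second
   entry marks u = [b u], which is outside that strict segment. *)
exists (fun u => if pselect (u = b u) then (a0, (c (b u)).*2)
                 else (f (b u) u, (c (b u)).*2.+1)) => u v.
have [Abu ubu] := bP u; have [Abv vbv] := bP v.
case: pselect => hu; case: pselect => hv [].
- by move=> /double_inj/cinj-/(_ Abu Abv) e; rewrite hu e -hv.
- by move=> _ /(congr1 odd); rewrite /= !odd_double.
- by move=> _ /(congr1 odd); rewrite /= !odd_double.
- move=> + /double_inj/cinj => /[swap] /(_ Abu Abv) e; rewrite -e => h.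
  by apply: (finj (b u)) => //; split=> //; rewrite e.
Qed.

Lemma segment_aleph1_countable (u : aleph 1) : countable (segment (@cle (aleph 1)) u).
Proof. exact: (succ_cardE aleph0).2. Qed.

(** Induction: a countable subset of [aleph n.+1] lies below some u, and [f u] embeds this segment
    in [aleph n], where the previous family covers the image. So pairs (u, i) index the next family.
    The size of [I] is bounded by a Tukey map, which passes to pairs by [tukey_map_fin_prod]. *)
Lemma countable_cofinal_family (n : nat) :
  exists (I : Type) (C : I -> set (aleph n)),
    [/\ forall i, countable (C i),
        forall A, countable A -> exists i, A `<=` C i
      & tukey_map (finD I) (finD (aleph n))].
Proof.
elim: n => [|n [I [C [Cc Ccof tI]]]].
  exists unit, (fun=> setT); split=> [_||].
  - exact: countableP.
  - by exists tt.
  - by apply: (@tukey_map_fin _ _ (fun=> 0%N)) => -[] [].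
have [f finj] := segment_aleph_inj n.
exists (aleph n.+1 * I)%type, (fun z => [set y | segment (@cle (aleph n.+1)) z.1 y
  /\ C z.2 (f z.1 y)]); split.
- move=> [u i] /=; have [c cinj] := countable_inj (Cc i).
  apply: (@inj_countable _ _ (c \o f u)) => x y [ux Cx] [uy Cy] /cinj-/(_ Cx Cy).
  exact: finj.
- move=> A cA; have [u Au] := countable_aleph_bounded cA.
  have [|i Ai] := Ccof (f u @` A); first exact: card_le_trans (card_image_le _ _) cA.
  by exists (u, i) => x Ax; split; [exact: Au|apply: Ai; exists x].
- apply: tukey_map_trans (tukey_map_fin_prod _ _) _.
  apply: tukey_map_prod; first exact: tukey_map_refl.
  apply: tukey_map_trans tI _.
  by have [g ginj] := (card_le_injP _ _).1 (aleph_leS n); exact: tukey_map_fin ginj.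
Qed.

(** If a countable A is unbounded, send u to the number of some [b u] in A above it. Only finitely
    many members of A have number at most p, and a bound of these bounds all such u. *)
Lemma cofinality_dichotomy (a : cardinal) (a0 : [set: a] !=set0) :
  tukey_map (cardD a0) (omegaD 0) \/
  (forall A : set a, countable A -> exists u, forall x, A x -> cle x u).
Proof.
have [h|/existsNP[A /not_implyP[cA nbd]]] := pselect (forall A : set a,
  countable A -> exists u, forall x, A x -> cle x u); [by right|left].
have [c cinj] := countable_inj cA.
have /choice[b bP] : forall u, exists x, A x /\ cle u x.
  move=> u; apply: contrapT => h; apply: nbd; exists u => x Ax.
  by have [//|ux] := wo_total (@cle_wo a) x u; exfalso; apply: h; exists x.
exists (c \o b) => p.
have fA : finite_set [set x | A x /\ (c x <= p)%N].
  apply: (@finite_inj_bounded _ _ c p) => [x [] //|x y [Ax _] [Ay _]].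
  exact: cinj.
have [u0 hu0] := @dle_ub (cardD a0) _ fA.
exists u0 => u /= cu; have [Abu ubu] := bP u.
by apply: (wo_trans (@cle_wo a)) ubu _; exact: hu0.
Qed.

Lemma tukey_map_countable_fibers (a : cardinal) (a0 : [set: a] !=set0)
    (P : directedSet) (psi : a -> P) :
  (forall A : set a, countable A -> exists u, forall x, A x -> cle x u) ->
  (forall p, countable [set x | dle (psi x) p]) -> tukey_map (cardD a0) P.
Proof.
move=> bd cpsi; exists psi => p; have [u hu] := bd _ (cpsi p).
by exists u.
Qed.

End cofinality.

(** * Compact sets in metrizable spaces *)

Local Open Scope ring_scope.

Lemma finite_filter_forall (I T : Type) (F : set_system T) (G : set I)
    (P : I -> set T) : Filter F -> finite_set G -> (forall i, G i -> F (P i)) ->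
  F [set y | forall i, G i -> P i y].
Proof.
move=> FF /(@finite_seqP {classic I})[s ->].
elim: s => [|i s IH] h; first exact: filterS filterT.
have Fi : F (P i) by apply: h; rewrite /= inE eqxx.
have Fs : F [set y | forall i, [set` s] i -> P i y].
  by apply: IH => j js; apply: h; rewrite /= inE js orbT.
by apply: filterS (filterI Fi Fs) => y [Pi Ps] j /=; rewrite inE => /orP[/eqP->//|/Ps].
Qed.

(** If [Q K] failed, the sets whose complement in K satisfies Q would form a proper filter
    containing K. Near a cluster point x in K, the given neighbourhood U would have its complement
    in the filter, a contradiction. *)
Lemma compact_ind (T : topologicalType) (K : set T) (Q : set T -> Prop) :
  Q set0 -> (forall A B, A `<=` B -> Q B -> Q A) ->
  (forall A B, Q A -> Q B -> Q (A `|` B)) -> compact K ->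
  (forall x, K x -> exists2 U, nbhs x U & Q (K `&` U)) -> Q K.
Proof.
move=> Q0 Qsub QU cK hK; apply: contrapT => nQK.
pose F : set_system T := fun A => Q (K `\` A).
have FF : ProperFilter F.
  split; first by rewrite /F setD0.
  split; rewrite /F.
  - by rewrite setDT.
  - by move=> A B QA QB; rewrite setDIr; exact: QU.
  - by move=> A B AB; apply: Qsub; exact: setDS.
have [|x [Kx clx]] := cK F FF; first by rewrite /F setDv.
have [U xU QU'] := hK x Kx.
have FU : F (~` U) by rewrite /F setDE setCK.
by have [y []] := clx _ _ FU xU.
Qed.

(* Values in an arbitrary archimedean field let [rat] carry its own metric. *)
Record metrizes (F : archiRealFieldType) (X : topologicalType)
    (d : X -> X -> F) : Prop := Metrizes {
  metrizes_xx : forall x, d x x = 0;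
  metrizes_gt0 : forall x y, x <> y -> 0 < d x y;
  metrizes_sym : forall x y, d x y = d y x;
  metrizes_tri : forall y x z, d x z <= d x y + d y z;
  metrizes_nbhs : forall x U,
    nbhs x U <-> exists n : nat, forall y, d x y < n.+1%:R^-1 -> U y
}.

Section metric.
Variables (F : archiRealFieldType) (X : topologicalType) (d : X -> X -> F).
Hypothesis dm : metrizes d.

Local Notation rad n := (n.+1%:R^-1 : F).

Let dxx := metrizes_xx dm.
Let dpos := metrizes_gt0 dm.
Let dC := metrizes_sym dm.
Let dtri := metrizes_tri dm.
Let dnbhs := metrizes_nbhs dm.

Lemma rad_gt0 n : 0 < rad n.
Proof. by rewrite invr_gt0 ltr0n. Qed.

Lemma rad_le m n : (m <= n)%N -> rad n <= rad m.
Proof. by move=> mn; rewrite lef_pV2 ?posrE ?ltr0n// ler_nat. Qed.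

Lemma rad_lt n : rad n.+1 < rad n.
Proof. by rewrite ltf_pV2 ?posrE ?ltr0n// ltr_nat. Qed.

Lemma rad_small (r : F) : 0 < r -> exists n : nat, rad n < r.
Proof.
move=> r0; exists (Num.bound r^-1).
rewrite -[ltRHS]invrK ltf_pV2 ?posrE ?ltr0n ?invr_gt0//.
apply: lt_le_trans (archi_boundP _) _; first by rewrite invr_ge0 ltW.
by rewrite ler_nat.
Qed.

Lemma dist_ge0 x y : 0 <= d x y.
Proof. by have [->|/dpos/ltW//] := pselect (x = y); rewrite dxx. Qed.

Lemma nbhs_dist x (r : F) : 0 < r -> nbhs x [set y | d x y < r].
Proof.
by move=> /rad_small[n nr]; apply/dnbhs; exists n => y /lt_trans; exact.
Qed.

Definition cnbhd (r : F) (G : set X) : set X := [set y | exists2 g, G g & d g y <= r].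

Lemma closed_dist (x : X) (r : F) : closed [set y | d x y <= r].
Proof.
move=> y ycl /=; rewrite leNgt; apply/negP => h.
have [z /= [zr yz]] := ycl _ (@nbhs_dist y (d x y - r) ltac:(lra)).
by have := dtri z x y; rewrite [d z y]dC; move: yz => /=; lra.
Qed.

Lemma metrizes_hausdorff : hausdorff_space X.
Proof.
move=> x y xy; apply: contrapT => /dpos h.
have r0 : 0 < d x y / 2 by lra.
have [z [/= xz yz]] := xy _ _ (nbhs_dist x r0) (nbhs_dist y r0).
by have := dtri z x y; rewrite [d z y]dC; lra.
Qed.

Lemma closed_cnbhd (r : F) (G : set X) : finite_set G -> closed (cnbhd r G).
Proof.
move=> fG; have -> : cnbhd r G = \bigcup_(g in G) [set y | d g y <= r].
  by apply/seteqP; split=> y [g Gg h]; exists g.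
by apply: closed_bigcup => // g _; exact: closed_dist.
Qed.

Definition funnel (G : set X) (L : nat -> set X) : set X :=
  [set y | forall n, cnbhd (rad n) G y \/ L n y].

(** A filter on the funnel that clusters at no point of G contains, for some N, the points farther
    than 1/(N+1) from all of G. It then contains [L N] and clusters there; the funnel is closed. *)
Lemma funnel_compact (G : set X) (L : nat -> set X) : finite_set G ->
  (forall n, compact (L n)) -> compact (funnel G L).
Proof.
move=> fG cL.
have clM : closed (funnel G L).
  have -> : funnel G L = \bigcap_n (cnbhd (rad n) G `|` L n).
    by apply/seteqP; split=> y h n; [move=> _|]; exact: h.
  apply: closed_bigI => n _; apply: closedU; first exact: closed_cnbhd.
  by apply: compact_closed; [exact: metrizes_hausdorff|exact: cL].
move=> FF pF FM.
have [[g [Gg gcl]]|nG] := pselect (exists g, G g /\ cluster FF g).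
  by exists g; split=> // n; left; exists g => //; rewrite dxx ltW ?rad_gt0.
have hG g : exists n, G g -> FF [set y | rad n < d g y].
  have [Gg|] := pselect (G g); last by exists 0%N.
  have [h|h] := pselect (forall n, ~ FF [set y | rad n < d g y]).
    exfalso; apply: nG; exists g; split=> // A B FA /dnbhs[n nB].
    apply: contrapT => AB; apply: (h n.+1); apply: filterS FA => y Ay /=.
    rewrite ltNge; apply/negP => gy; apply: AB; exists y; split=> //.
    by apply: nB; exact: le_lt_trans gy (rad_lt n).
  by move/existsNP : h => [n /contrapT Fn]; exists n.
have [n hn] := choice hG.
have [N hN] := @dle_ub (omegaD 0) _ (finite_image n fG).
have FL : FF (L N).
  have := finite_filter_forall _ fG hn => FG.
  apply: filterS (filterI (FG _) FM) => y [h /(_ N)[[g Gg gN]|//]].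
  have := h g Gg; rewrite /= ltNge => /negP; case.
  by apply: le_trans gN (rad_le _); apply: hN; exists g.
have [z [Lz zcl]] := cL N FF pF FL.
exists z; split=> //; apply: clM => B zB.
exact: zcl.
Qed.

(** Take a filter on A without cluster point in A. Let [U k] be the union of those balls, with
    number of the centre and index of the radius at most k, whose complement is in the filter. These
    finitely many balls miss some point [s k] of A, while the [U k] increase and cover A, so one of
    them covers the part of K in A. *)
Lemma dense_sequence_gap (A : set X) : separable X -> closed A -> ~ compact A ->
  exists s : nat -> X, (forall k, A (s k)) /\
    forall K, compact K -> exists k, forall j, K (s j) -> (j < k)%N.
Proof.
move=> [D cD dD] clA ncA.
have [FF [pF FA ncl]] : exists FF : set_system X,
    [/\ ProperFilter FF, FF A & ~ (A `&` cluster FF !=set0)].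
  apply: contrapT => h; apply: ncA => FF pF FA.
  by apply: contrapT => ncl; apply: h; exists FF.
have [c cinj] := countable_inj cD.
pose b (z : X * nat) : set X := [set y | d z.1 y < rad z.2].
pose U k : set X := [set y | exists z : X * nat,
  [/\ D z.1, (c z.1 <= k)%N, (z.2 <= k)%N, FF (~` b z) & b z y]].
have FU k : FF (~` U k).
  pose I : set (X * nat) := [set z | [/\ D z.1, (c z.1 <= k)%N & (z.2 <= k)%N]].
  have fI : finite_set (I `&` [set z | FF (~` b z)]).
    apply: finite_setIl.
    apply: (@finite_inj_bounded _ _ (fun z => pickle (c z.1, z.2))
      (\max_(w : 'I_k.+1 * 'I_k.+1) pickle (w.1 : nat, w.2 : nat))%N).
      move=> [x m] [/= Dx ck mk].
      exact: (leq_bigmax (Ordinal (ck : c x < k.+1)%N, Ordinal (mk : m < k.+1)%N)).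
    move=> [x m] [y l] [/= Dx _ _] [/= Dy _ _] /(pcan_inj pickleK)[/cinj h ->].
    by rewrite h.
  apply: filterS (@finite_filter_forall _ _ FF _ (fun z => ~` b z) _ fI _).
    by move=> y /= h [z [Dz ck mk Fz bz]]; exact: (h z).
  by move=> z [].
have AU x : A x -> exists k, nbhs x (U k).
  move=> Ax; have nx : ~ cluster FF x by move=> h; apply: ncl; exists x.
  move/existsNP : nx => [S /existsNP[B /not_implyP[FS /not_implyP[xB SB]]]].
  have [n nB] := (dnbhs _ _).1 xB.
  (* A point q of D within 1/(m+1) of x, where 1/(m+1) is less than half of 1/(n+1), centres a ball
     that contains x and lies in B, so it misses S. *)
  have r0 : 0 < rad n / 2 by rewrite divr_gt0 ?rad_gt0.
  have [m mn] := rad_small r0.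
  have [q [qx Dq]] : [set y | d x y < rad m]^° `&` D !=set0.
    apply: dD; last exact: open_interior.
    by exists x; apply: nbhs_dist; exact: rad_gt0.
  have {}qx : d x q < rad m := interior_subset qx.
  exists (maxn (c q) m); apply: filterS (nbhs_dist x (_ : 0 < rad m - d q x)).
    move=> y /= xy; exists (q, m); split=> //=; rewrite ?leq_maxl ?leq_maxr//.
      apply: filterS FS => z Sz /= qz; apply: SB; exists z; split=> //.
      apply: nB; apply: le_lt_trans (dtri q _ _) _.
      by move: mn qx (qz : d q z < rad m); move: (rad m) (rad n) => rm rn; lra.
    by have := dtri x q y; move: xy; rewrite /b /=; move: (rad m) => r; lra.
  by rewrite dC subr_gt0.
have mono j k : (j <= k)%N -> U j `<=` U k.
  move=> jk y [z [Dz ck mk Fz bz]]; exists z; split=> //; exact: leq_trans jk.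
have hk k : exists x, A x /\ ~ U k x.
  have [x [Ax Ux]] := filter_ex (filterI FA (FU k)).
  by exists x.
have [s hs] := choice hk; exists s; split=> [k|K cK]; first by have [] := hs k.
have [k kU] : exists k, K `&` A `<=` U k.
  apply: (@compact_ind _ (K `&` A) (fun S => exists k, S `<=` U k)).
  - by exists 0%N.
  - by move=> S T ST [k Tk]; exists k; exact: subset_trans Tk.
  - move=> S T [k Sk] [l Tl]; exists (maxn k l) => y [/Sk|/Tl]; apply: mono.
      exact: leq_maxl.
    exact: leq_maxr.
  - exact: compact_closedI.
  - by move=> x [_ /AU[k xk]]; exists (U k) => //; exists k => y [].
exists k => j Kj; rewrite ltnNge; apply/negP => kj.
have [Asj nUj] := hs j; apply: nUj; apply: mono kj _ _; exact: kU.
Qed.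

End metric.

Lemma nbhs_cantorP (s : cantor_space) (U : set cantor_space) :
  nbhs s U <-> exists n, forall t, (forall i, (i < n)%N -> t i = s i) -> U t.
Proof.
split=> [sU|[n nU]]; last first.
  have := @finite_filter_forall _ _ (nbhs s) `I_n (fun i => [set t | t i = s i])
    (nbhs_filter s) (finite_II n).
  move=> h; apply: filterS (h _) => // i _.
  have := @proj_continuous nat (fun=> bool) i s [set s i].
  by apply; rewrite nbhs_principalE.
pose F := filter_from setT (fun n =>
  [set t : cantor_space | forall i, (i < n)%N -> t i = s i]).
have FF : Filter F.
  apply: filter_from_filter; first by exists 0%N.
  move=> i j _ _; exists (maxn i j) => // t h; split=> k kl; apply: h.
    by rewrite leq_max kl.
  by rewrite leq_max kl orbT.
suff : F --> s by move=> /(_ U sU)[n _ nU]; exists n.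
apply/cvg_sup => i V [? /= [[W oW <-]] /= Ws /filterS]; apply.
by exists i.+1 => // t /= h; rewrite h.
Qed.

(** * Cantor sets from dense-in-itself sets *)

Section perfect.
Variables (F : archiRealFieldType) (X : topologicalType) (d : X -> X -> F).
Hypothesis dm : metrizes d.

Local Notation rad n := (n.+1%:R^-1 : F).

Let dxx := metrizes_xx dm.
Let dpos := metrizes_gt0 dm.
Let dC := metrizes_sym dm.
Let dtri := metrizes_tri dm.
Let dnbhs := metrizes_nbhs dm.

Definition dense_in_itself (Q : set X) :=
  forall x (r : F), Q x -> 0 < r -> exists y, [/\ Q y, y <> x & d x y < r].

Section cantor_scheme.
Variables (Q : set X) (y : X * F -> X) (x0 : X).
Hypothesis yP : forall z, Q z.1 -> 0 < z.2 ->
  [/\ Q (y z), y z <> z.1 & d z.1 (y z) < z.2 / 2].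
Hypothesis Qx0 : Q x0.

(** A centre and a radius for each finite branch. One child keeps the centre, the other moves to
    [y z], closer than half the radius; both get a third of this distance as radius, so that the
    closed balls are nested and siblings are disjoint. *)
Fixpoint node (s : nat -> bool) (n : nat) : X * F :=
  if n is m.+1 then
    let z := node s m in (if s m then y z else z.1, d z.1 (y z) / 3)
  else (x0, 1).

Lemma nodeP s n : Q (node s n).1 /\ 0 < (node s n).2.
Proof.
elim: n => [|n [Qn rn]] /=; first by rewrite ltr01.
have [Qy ny _] := yP Qn rn; split; first by case: ifP.
by rewrite divr_gt0// dpos// => /esym.
Qed.

Lemma node_eq s t n : (forall i, (i < n)%N -> s i = t i) -> node s n = node t n.
Proof.
elim: n => //= n IH h; rewrite IH => [|i ni]; first by rewrite h.
by apply: h; exact: leqW.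
Qed.

Lemma node_step s n : d (node s n).1 (node s n.+1).1 + (node s n.+1).2 <= (node s n).2.
Proof.
have [Qn rn] := nodeP s n; have [_ _ h] := yP Qn rn.
have := dist_ge0 dm (node s n).1 (y (node s n)).
by move: h rn => /=; case: ifP => _; rewrite ?dxx; lra.
Qed.

Lemma node_rad s n : (node s n).2 <= rad n.
Proof.
elim: n => [|n IH]; first by rewrite invr1.
have [Qn rn] := nodeP s n; have [_ _ h] := yP Qn rn.
apply: (@le_trans _ _ (rad n / 2)); first by move: IH rn h => /=; move: (rad n) => r; lra.
rewrite -invfM lef_pV2 ?posrE ?mulr_gt0 ?ltr0n// -natrM ler_nat.
by rewrite muln2 -addnn addSn addnS !ltnS leq_addr.
Qed.

Lemma node_nested s n k :
  d (node s n).1 (node s (n + k)).1 + (node s (n + k)).2 <= (node s n).2.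
Proof.
elim: k => [|k IH]; first by rewrite addn0 dxx add0r.
rewrite addnS; have := node_step s (n + k).
by have := dtri (node s (n + k)).1 (node s n).1 (node s (n + k).+1).1; lra.
Qed.

Lemma node_lim (K : set X) s : compact K -> Q `<=` K ->
  exists x, K x /\ forall n, d (node s n).1 x <= (node s n).2.
Proof.
move=> cK QK.
pose FF : set_system X := [set A | exists N, forall n, (N <= n)%N -> A (node s n).1].
have pF : ProperFilter FF.
  split; first by move=> [N /(_ N (leqnn N))].
  split; first by exists 0%N.
  - move=> A B [N hA] [M hB]; exists (maxn N M) => n; rewrite geq_max => /andP[Nn Mn].
    by split; [exact: hA|exact: hB].
  - by move=> A B AB [N hA]; exists N => n /hA/AB.
have [|x [Kx xcl]] := cK FF pF; first by exists 0%N => n _; exact: QK (nodeP s n).1.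
exists x; split=> // n; apply: (@closed_dist _ _ _ dm) => B xB.
have [|z [zn Bz]] := xcl [set z | d (node s n).1 z <= (node s n).2] B _ xB.
  exists n => m /subnKC <- /=.
  have := node_nested s n (m - n); have [_] := nodeP s (n + (m - n)); lra.
by exists z.
Qed.

(* After the splitting the branches lie in balls of radius [r] whose centres
   are at distance [3 r]. *)
Lemma node_sep (s t : nat -> bool) n x z : node s n = node t n -> s n <> t n ->
  d (node s n.+1).1 x <= (node s n.+1).2 -> d (node t n.+1).1 z <= (node t n.+1).2 ->
  (node s n.+1).2 <= d x z.
Proof.
move=> st nst /=; rewrite -st; set w := node s n.
have : d w.1 (y w) <= d w.1 x + d x z + d z (y w).
  by have := dtri x w.1 (y w); have := dtri z x (y w); lra.
have : d w.1 (y w) <= d w.1 z + d x z + d x (y w).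
  by have := dtri z w.1 (y w); have := dtri x z (y w); rewrite [d z x]dC; lra.
rewrite [d z _]dC [d x (y w)]dC.
by move: nst; case: (s n); case: (t n) => // _; lra.
Qed.

End cantor_scheme.

(** The nodes of the scheme stay in Q, and compactness of K gives the limit [f s] of each branch.
    Shrinking radii make [f] continuous; disjoint siblings make it injective with continuous
    inverse. *)
Lemma perfect_cantor (K Q : set X) : compact K -> Q `<=` K -> Q !=set0 ->
  dense_in_itself Q -> exists A : set X, homeomorphic A cantor_space.
Proof.
move=> cK QK [x0 Qx0] dQ.
have /choice[y yP] : forall z : X * F, exists y, Q z.1 -> 0 < z.2 ->
    [/\ Q y, y <> z.1 & d z.1 y < z.2 / 2].
  move=> [x r] /=; have [[Qx r0]|h] := pselect (Q x /\ 0 < r).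
    by have [|y h] := dQ x (r / 2) Qx; [rewrite divr_gt0|exists y].
  by exists x => Qx r0; exfalso; apply: h.
pose nd := node y x0.
have /choice[f fP] : forall s : cantor_space, exists x, forall n, d (nd s n).1 x <= (nd s n).2.
  by move=> s; have [x [_ h]] := node_lim yP Qx0 s cK QK; exists x.
pose r s n := (nd s n).2.
have r_gt0 s n : 0 < r s n := (nodeP yP Qx0 s n).2.
have r_anti s m n : (m <= n)%N -> r s n <= r s m.
  move=> /subnKC <-; have := node_nested yP Qx0 s m (n - m).
  by have := dist_ge0 dm (nd s m).1 (nd s (m + (n - m))%N).1; rewrite /r /nd; lra.
(* At a first difference i < n the two branches would be at least [r s i.+1] apart, which is at
   least [r s n]. *)
have sep s t n : d (f s) (f t) < r s n -> forall i, (i < n)%N -> t i = s i.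
  move=> h i; elim/ltn_ind : i => i IH ni.
  have e : nd s i = nd t i by apply: node_eq => j ji; rewrite IH// (ltn_trans ji).
  apply: contrapT => /nesym nst.
  have := lt_le_trans h (r_anti s i.+1 n ni); rewrite ltNge => /negP; apply.
  exact: node_sep e nst (fP s i.+1) (fP t i.+1).
have finj : injective f.
  move=> s t e; apply/funext => i; apply/esym; apply: (sep s t i.+1) => //.
  by rewrite e dxx.
pose A := range f.
have fA s : f s \in A by rewrite inE; exists s.
pose G (s : cantor_space) : A := SigSub (fA s).
have /choice[g gP] : forall a : A, exists s, f s = set_val a.
  by move=> [a aA]; have [s _ e] := set_mem aA; exists s.
have gK : cancel g G by move=> a; apply/val_inj; exact: gP.
have Gg : cancel G g by move=> s; apply: finj; rewrite gP.
exists A, g, G; split=> //.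
- move=> a U /nbhs_cantorP[n nU].
  have := nbhs_dist dm (f (g a)) (r_gt0 (g a) n); rewrite {1}gP.
  move=> /(@initial_continuous _ _ (set_val : A -> X) a) aV.
  apply: (@filterS _ (nbhs a) _ _ _ _ aV) => b /= h.
  by apply: nU; apply: sep; rewrite (gP b).
- move=> s U [_ /= [[W oW <-]] /= Ws /filterS]; apply.
  have [k kU] := (dnbhs _ _).1 (open_nbhs_nbhs (conj oW Ws)).
  have [n nk] : exists n, rad n < rad k / 2 by apply: rad_small; rewrite divr_gt0 ?rad_gt0.
  apply/nbhs_cantorP; exists n => t ts; apply: kU => /=.
  have e : nd s n = nd t n by apply: node_eq => i /ts.
  have := fP t n; rewrite -e => h1; have h2 := fP s n.
  have h3 : (nd s n).2 <= rad n := node_rad yP Qx0 s n.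
  have := dtri (nd s n).1 (f s) (f t); rewrite [d (f s) (nd s n).1]dC.
  move: nk h1 h2 h3; move: (rad n) (rad k) => rn rk; lra.
Qed.

End perfect.

(** * Ranks of compact sets *)

Lemma finite_bigcup_compact (T : topologicalType) (I : Type) (D : set I)
    (f : I -> set T) : finite_set D -> (forall i, D i -> compact (f i)) ->
  compact (\bigcup_(i in D) f i).
Proof.
move=> /(@finite_seqP {classic I})[s ->].
elim: s => [|i s IH] h; first by rewrite set_nil bigcup_set0; exact: compact0.
have -> : \bigcup_(j in [set` i :: s]) f j = f i `|` \bigcup_(j in [set` s]) f j.
  by apply/seteqP; split=> [x [j] /=|x [fx|[j /= js fx]]];
    [rewrite inE => /orP[/eqP->|js] fx; [left|right; exists j]
    |exists i; rewrite //= inE eqxx|exists j; rewrite //= inE js orbT].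
apply: compactU; first by apply: h; rewrite /= inE eqxx.
by apply: IH => j js; apply: h; rewrite /= inE js orbT.
Qed.

Section rank.
Variables (F : archiRealFieldType) (X : topologicalType) (d : X -> X -> F).
Hypothesis dm : metrizes d.

Local Notation rad n := (n.+1%:R^-1 : F).
Local Notation W := (aleph 1).
Local Notation below := (segment (@cle (aleph 1))).

Let dxx := metrizes_xx dm.
Let dpos := metrizes_gt0 dm.
Let dC := metrizes_sym dm.
Let dtri := metrizes_tri dm.
Let dnbhs := metrizes_nbhs dm.

(** A form of the Cantor-Bendixson rank, read as rank at most a. The finite set G acts as the last
    derivative: off each neighbourhood of G the rank drops below a. Taking G in C, and not in A,
    makes the predicate hereditary in A and lets finite subsets of C serve as codes. *)
Inductive rank (C : set X) : W -> set X -> Prop :=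
| rank_set0 a : rank C a set0
| rank_step a A G (b : nat -> W) : finite_set G -> G `<=` C ->
    (forall n, below a (b n)) ->
    (forall n, rank C (b n) (A `\` cnbhd d (rad n) G)) -> rank C a A.

Lemma rank_sub C a A B : A `<=` B -> rank C a B -> rank C a A.
Proof.
move=> + rB; elim: rB A => {a B} [a A|a B G b fG GC ba _ IH A AB].
  by rewrite subset0 => ->; exact: rank_set0.
by apply: (rank_step fG GC ba) => n; apply: IH; exact: setSD.
Qed.

Lemma rank_le C a a' A : cle a a' -> rank C a A -> rank C a' A.
Proof.
move=> aa' rA; move: aa'; case: rA => {a A} [a|a A G b fG GC ba rb] aa'.
  exact: rank_set0.
by apply: (rank_step fG GC _ rb) => n; exact: (segment_le_trans (@cle_wo W) aa').
Qed.

Lemma rankU C a A B : rank C a A -> rank C a B -> rank C a (A `|` B).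
Proof.
elim/(wo_ind (@cle_wo W)) : a A B => a IH A B rA rB.
case: rA IH rB => {a A} [a|a A G b fG GC ba rb] IH; first by rewrite set0U.
move=> rB; case: rB IH ba => {a B} [a|a B G' b' fG' GC' ba' rb'] IH ba.
  by rewrite setU0; exact: rank_step rb.
pose c n := if cle (b n) (b' n) then b' n else b n.
have bc n : cle (b n) (c n).
  by rewrite /c; case: ifP => // _; exact: (wo_refl (@cle_wo W)).
have bc' n : cle (b' n) (c n).
  rewrite /c; case: ifP => [_|]; first exact: (wo_refl (@cle_wo W)).
  by have [->//|//] := wo_total (@cle_wo W) (b n) (b' n).
have ca n : below a (c n) by rewrite /c; case: ifP.
apply: (@rank_step _ _ _ (G `|` G') c) => // [||n].
- by rewrite finite_setU.
- by rewrite subUset.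
- apply: rank_sub (IH _ (ca n) _ _ (rank_le (bc n) (rb n)) (rank_le (bc' n) (rb' n))).
  move=> y [[Ay|By] ny]; [left|right]; split=> // -[g Gg gy]; apply: ny.
    by exists g => //; left.
  by exists g => //; right.
Qed.

Lemma cnbhd_all (G : set X) y : finite_set G -> (forall n, cnbhd d (rad n) G y) -> G y.
Proof.
move=> fG h; apply: contrapT => nGy.
have /choice[n hn] : forall g, exists n, G g -> rad n < d g y.
  move=> g; have [Gg|nGg] := pselect (G g); last by exists 0%N.
  have [|n hn] := @rad_small F (d g y); last by exists n.
  by apply: dpos => gy; apply: nGy; rewrite -gy.
have [N hN] := @dle_ub (omegaD 0) _ (finite_image n fG).
have [g Gg gN] := h N.
have nN : (n g <= N)%N by apply: hN; exists g.
have := le_trans gN (rad_le F nN).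
by rewrite leNgt hn.
Qed.

Lemma rank_countable C a A : rank C a A -> countable A.
Proof.
elim=> {a A} [a|a A G b fG GC ba _ IH]; first exact: countable0.
pose D n := if n is m.+1 then A `\` cnbhd d (rad m) G else G.
have cD : countable (\bigcup_n D n).
  apply: bigcup_countable => // -[|n] _ /=; last exact: IH.
  exact: finite_set_countable.
apply: sub_countable cD; apply: subset_card_le => y Ay.
apply: contrapT => nD; apply: (nD); exists 0%N => //=.
apply: cnbhd_all => // n; apply: contrapT => ny.
by apply: nD; exists n.+1.
Qed.

Definition ranked C A := exists a, rank C a A.

Lemma ranked_sub C A B : A `<=` B -> ranked C B -> ranked C A.
Proof. by move=> AB [a ra]; exists a; exact: rank_sub ra. Qed.

Lemma rankedU C A B : ranked C A -> ranked C B -> ranked C (A `|` B).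
Proof.
move=> [a ra] [b rb]; have [ab|ba] := wo_total (@cle_wo W) a b.
  by exists b; apply: rankU => //; exact: rank_le ra.
by exists a; apply: rankU => //; exact: rank_le rb.
Qed.

Lemma ranked0 C : ranked C set0.
Proof. by have [a _] := aleph_neq0 1; exists a; exact: rank_set0. Qed.

(** Countably many elements of omega_1 have a strict upper bound. *)
Lemma ranked_limit C A G : finite_set G -> G `<=` C ->
  (forall n, ranked C (A `\` cnbhd d (rad n) G)) -> ranked C A.
Proof.
move=> fG GC /choice[b rb].
have cb : countable (range b) by apply: card_le_trans (card_image_le _ _) (countableP _).
have [a ha] := countable_aleph_bounded cb.
exists a; apply: (rank_step fG GC _ rb) => n; apply: ha; exact: imageT.
Qed.

Lemma compact_ranked C K : (forall A : set X, ~ homeomorphic A cantor_space) ->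
  compact K -> K `<=` C -> ranked C K.
Proof.
move=> ti cK KC; apply: contrapT => nK.
pose ker := [set x | K x /\ forall n, ~ ranked C (K `&` [set y | d x y < rad n])].
have nker x : K x -> ~ ker x -> exists2 U, nbhs x U & ranked C (K `&` U).
  move=> Kx nx; apply: contrapT => h; apply: nx; split=> // n rn; apply: h.
  by exists [set y | d x y < rad n] => //; apply: nbhs_dist => //; exact: rad_gt0.
have kerK : ker `<=` K by move=> x [].
have ker_neq0 : ker !=set0.
  apply/set0P/negP => /eqP ker0; apply: nK.
  apply: (compact_ind (@ranked0 C) (@ranked_sub C) (@rankedU C) cK) => x Kx.
  by apply: nker => //; rewrite ker0.
suff kerd : dense_in_itself d ker.
  by have [A] := perfect_cantor dm cK kerK ker_neq0 kerd; exact: ti.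
(* If x were isolated in [ker], the part of K near x would be ranked with G = {x}: the other points
   of K in a small closed ball about x are outside [ker], and compactness combines their ranked
   neighbourhoods. *)
move=> x r [Kx xker] r0; apply: contrapT => iso.
have [n nr] := rad_small r0; apply: (xker n).
apply: (@ranked_limit _ _ [set x]) => // [_ ->|m]; first exact: KC.
pose L := K `&` [set y | d x y <= rad n].
have cL : compact L.
  by apply: compact_closedI => //; exact: closed_dist.
apply: (@ranked_sub _ _ (L `\` cnbhd d (rad m) [set x])).
  by move=> y [[Ky /= yx] ny]; split=> //; split=> //=; exact: ltW.
apply: (@compact_ind _ L (fun S => ranked C (S `\` cnbhd d (rad m) [set x]))) => //.
- by rewrite set0D; exact: ranked0.
- by move=> S T ST; apply: ranked_sub; exact: setSD.
- by move=> S T rS rT; rewrite setDUl; exact: rankedU.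
move=> y [Ky yn]; have [yker|/nker-/(_ Ky)[U yU rU]] := pselect (ker y); last first.
  by exists U => //; apply: ranked_sub rU => z [[[Kz _] Uz] _].
have -> : y = x.
  apply: contrapT => yx; apply: iso; exists y; split=> //.
  exact: le_lt_trans yn nr.
exists [set z | d x z < rad m]; first by apply: nbhs_dist => //; exact: rad_gt0.
apply: ranked_sub (@ranked0 C) => z [[_ xz] nz]; apply: nz.
by exists x => //; exact: ltW.
Qed.

End rank.

(** * Upper bounds *)

Section tukey_bounded.
Variable X : topologicalType.

(** A Tukey map on a family of sets, with compact sets as bounds. The bounds may lie outside the
    family, so that it applies to classes such as [rank d C a]. *)
Definition tukey_bounded (P : directedSet) (E : set (set X)) : Prop :=
  exists g : set X -> P, forall p, exists2 L, compact L &
    forall A, E A -> dle (g A) p -> A `<=` L.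

Lemma tukey_bounded_sub (P : directedSet) (E E' : set (set X)) :
  E `<=` E' -> tukey_bounded P E' -> tukey_bounded P E.
Proof.
move=> EE' [g gP]; exists g => p; have [L cL h] := gP p.
by exists L => // A /EE'; exact: h.
Qed.

Lemma tukey_bounded_trans (P P' : directedSet) (E : set (set X)) :
  tukey_map P P' -> tukey_bounded P E -> tukey_bounded P' E.
Proof.
move=> [f fP] [g gP]; exists (f \o g) => p; have [q hq] := fP p.
by have [L cL h] := gP q; exists L => // A EA /hq; exact: h.
Qed.

(** Each set is coded together with one index of a class containing it. A bound admits finitely many
    indices, and the union of their compact bounds is compact. *)
Lemma tukey_bounded_bigcup (P : directedSet) (I : Type) (E : I -> set (set X)) :
  (forall i, tukey_bounded P (E i)) ->
  tukey_bounded (prodD P (finD I)) (\bigcup_i E i).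
Proof.
move=> /choice[g gP].
have [[i0]|nI] := pselect (exists _ : I, True); last first.
  have [p0 _] := @dle_ub P set0 (finite_set0 _).
  exists (fun=> (p0, exist _ set0 (finite_set0 I))) => ?.
  by exists set0; [exact: compact0|move=> A [i]; exfalso; apply: nI; exists i].
have /choice[i iP] : forall A, exists i, (\bigcup_i E i) A -> E i A.
  move=> A; have [[i _ Ei]|h] := pselect ((\bigcup_i E i) A); first by exists i.
  by exists i0.
exists (fun A => (g (i A) A, exist _ [set i A] (finite_set1 (i A)))) => z.
case: z => [q [J fJ]].
have /choice[L LP] : forall i, exists L, compact L /\
    forall A, E i A -> dle (g i A) q -> A `<=` L.
  by move=> j; have [L cL h] := gP j q; exists L.
exists (\bigcup_(j in J) L j).
  by apply: finite_bigcup_compact => // j _; have [] := LP j.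
move=> A EA [/= gp iJ] x Ax; exists (i A); first exact: iJ.
by have [_ h] := LP (i A); apply: h gp _ Ax; exact: iP.
Qed.

Lemma tukey_bounded_compactD (P : directedSet) :
  tukey_bounded P (@compact X) -> tukey_map (compactD X) P.
Proof.
move=> [g gP]; exists (fun K => g (sval K)) => p; have [L cL h] := gP p.
by exists (exist _ L cL) => -[K cK] /= gK; exact: h gK.
Qed.

End tukey_bounded.

(* [finD {x | C x} <=T P], stated without the subtype. *)
Definition fin_below (X : Type) (C : set X) (P : directedSet) : Prop :=
  exists psi : set X -> P, forall p, exists2 G0, finite_set G0 &
    forall G, finite_set G -> G `<=` C -> dle (psi G) p -> G `<=` G0.

Lemma fin_belowT (X : Type) (P : directedSet) :
  tukey_map (finD X) P -> fin_below [set: X] P.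
Proof.
move=> [f fP].
have [p0 _] := @dle_ub P set0 (finite_set0 _).
exists (fun G => if pselect (finite_set G) is left fG then f (exist _ G fG) else p0) => p.
have [[G0 fG0] h] := fP p; exists G0 => // G fG _.
by case: pselect => // fG' /h.
Qed.

Lemma fin_below_countable (X : Type) (C : set X) (P : directedSet) :
  countable C -> tukey_map (omegaD 0) P -> fin_below C P.
Proof.
move=> /countable_inj[c cinj] [f fP].
have /choice[m mP] : forall G : set X, exists n, finite_set G ->
    forall x, G x -> (c x <= n)%N.
  move=> G; have [fG|] := pselect (finite_set G); last by exists 0%N.
  have [n hn] := @dle_ub (omegaD 0) _ (finite_image c fG).
  by exists n => _ x Gx; apply: hn; exists x.
exists (f \o m) => p; have [n hn] := fP p.
exists [set x | C x /\ (c x <= n)%N].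
  apply: (@finite_inj_bounded _ _ c n) => [x [] //|x y [Cx _] [Cy _]]; exact: cinj.
move=> G fG GC /hn Gn x Gx; split; first exact: GC.
exact: leq_trans (mP G fG x Gx) Gn.
Qed.

Section upper.
Variables (F : archiRealFieldType) (X : topologicalType) (d : X -> X -> F).
Hypothesis dm : metrizes d.

Local Notation rad n := (n.+1%:R^-1 : F).
Local Notation W := (aleph 1).
Local Notation below := (segment (@cle (aleph 1))).

Lemma rank_tukey_bounded (P : directedSet) (C : set X) (a : W) :
  tukey_map (powD nat P) P -> tukey_map (omegaD 0) P -> fin_below C P ->
  tukey_bounded P (rank d C a).
Proof.
move=> powP [chi chiP] [psi psiP].
elim/(wo_ind (@cle_wo W)) : a => a IH.
apply: tukey_bounded_trans powP _.
have [c cinj] := countable_inj (segment_aleph1_countable a).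
have [p0 _] := @dle_ub P set0 (finite_set0 _).
have /choice[g gP] : forall b, exists g : set X -> P, below a b ->
    forall p, exists L, compact L /\ forall A, rank d C b A -> dle (g A) p -> A `<=` L.
  move=> b; have [/IH[g gP]|nab] := pselect (below a b); last by exists (fun=> p0).
  by exists g => _ p; have [L cL h] := gP p; exists L.
(* The empty set may be ranked by [rank_set0], which provides no G and no pieces; hence the
   restriction to nonempty A. *)
have /choice[dec decP] : forall A, exists z : set X * (nat -> W), rank d C a A ->
    A !=set0 -> [/\ finite_set z.1, z.1 `<=` C, forall n, below a (z.2 n) &
      forall n, rank d C (z.2 n) (A `\` cnbhd d (rad n) z.1)].
  move=> A; have [rA|nrA] := pselect (rank d C a A); last by exists (set0, fun=> a).
  case: rA => {A} [a'|a' A G b fG GC ba rb]; last by exists (G, b).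
  by exists (set0, fun=> a') => _ [].
pose rest A n := A `\` cnbhd d (rad n) (dec A).1.
(* Coordinate 0 codes G, coordinate 2n+1 the rank of the n-th piece, and coordinate 2n+2 that piece,
   by the map for its rank. *)
exists (fun A k => if k is k'.+1 then
    let n := k'./2 in let b := (dec A).2 n in
    if odd k' then g b (rest A n) else chi (c b)
  else psi (dec A).1) => p.
have [G0 fG0 hG0] := psiP (p 0%N).
have /choice[N hN] : forall n, exists N, forall m, dle (chi m) (p (n.*2.+1)) -> (m <= N)%N.
  by move=> n; have [N h] := chiP (p n.*2.+1); exists N.
have /choice[L hL] : forall z : W * nat, exists L, compact L /\ (below a z.1 ->
    forall A, rank d C z.1 A -> dle (g z.1 A) (p z.2.*2.+2) -> A `<=` L).
  move=> [b n] /=; have [ab|nab] := pselect (below a b).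
    by have [L [cL h]] := gP b ab (p n.*2.+2); exists L.
  by exists set0; split=> //; exact: compact0.
(* Coordinate 2n+1 leaves finitely many possible ranks for the n-th piece, so the union of the
   corresponding bounds is compact. *)
exists (funnel d G0 (fun n => \bigcup_(b in [set b | below a b /\ (c b <= N n)%N]) L (b, n))).
  apply: funnel_compact => // n; apply: finite_bigcup_compact.
    apply: (@finite_inj_bounded _ _ c (N n)) => [b [] //|b b' [ab _] [ab' _]].
    exact: cinj.
  by move=> b _; have [] := hL (b, n).
move=> A rA gA x Ax n.
have [fG GC ba rb] := decP A rA (ex_intro _ x Ax).
have GG0 : (dec A).1 `<=` G0 by apply: hG0 => //; exact: gA 0%N.
have [xG0|nxG0] := pselect (cnbhd d (rad n) G0 x); [by left|right].
exists ((dec A).2 n).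
  split=> //; apply: hN; have := gA n.*2.+1.
  by rewrite /= odd_double doubleK.
have [_ h] := hL ((dec A).2 n, n).
apply: (h (ba n) (rest A n)) => //=.
  by have := gA n.*2.+2; rewrite /= odd_double uphalf_double.
by split=> // -[y Gy yx]; apply: nxG0; exists y => //; exact: GG0.
Qed.

Hypothesis imperfect : forall A : set X, ~ homeomorphic A cantor_space.

Lemma compact_tukey_bounded (P : directedSet) (C : set X) :
  tukey_map (powD nat P) P -> tukey_map (omegaD 0) P -> fin_below C P ->
  tukey_bounded (prodD P (finD (aleph 1))) [set K | compact K /\ K `<=` C].
Proof.
move=> h1 h2 h3; apply: tukey_bounded_sub (tukey_bounded_bigcup
  (fun a => rank_tukey_bounded a h1 h2 h3)) => K [cK KC].
by have [a ra] := compact_ranked dm imperfect cK KC; exists a.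
Qed.

Lemma compact_countable (K : set X) : compact K -> countable K.
Proof.
move=> cK; have [a ra] := compact_ranked dm imperfect cK (@subsetT _ K).
exact: (rank_countable dm ra).
Qed.

(** Here C is the whole space: P lies above its own countable power, omega, the finite subsets of X,
    and those of omega_1, which pay for the union over all ranks. *)
Lemma compactD_le_fin_pow (k : cardinal) :
  [set: aleph 1] #<= [set: k] -> [set: X] #<= [set: k] ->
  tukey_map (compactD X) (powD nat (finD k)).
Proof.
move=> w1k Xk; set P := powD nat (finD k).
have finP : tukey_map (finD k) P := tukey_map_proj _.
have [f finj] := (card_le_injP _ _).1 w1k; have [h hinj] := (card_le_injP _ _).1 Xk.
have w1P : tukey_map (finD (aleph 1)) P := tukey_map_trans (tukey_map_fin finj) finP.
have XP : tukey_map (finD X) P := tukey_map_trans (tukey_map_fin hinj) finP.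
have wP : tukey_map (omegaD 0) P.
  apply: tukey_map_trans finP; apply: tukey_map_omega_fin.
  exact: card_le_trans (card_nat_aleph 1) w1k.
apply: tukey_map_trans (tukey_map_prod (tukey_map_refl P) w1P).
apply: tukey_bounded_compactD.
apply: tukey_bounded_sub (compact_tukey_bounded (tukey_map_pow_pow _) wP (fin_belowT XP)).
by move=> K cK; split.
Qed.

(** A compact set is countable, so it lies in the preimage under [h] of some [C i]. Inside one
    countable set, finite sets are coded in omega, and omega^omega suffices for each rank; the rank
    and the index i are recorded in the factor [finD k]. *)
Lemma compactD_le_baire_fin (n : nat) (k : cardinal) :
  [set: X] #<= [set: aleph n] -> [set: aleph n] #<= [set: k] ->
  [set: aleph 1] #<= [set: k] ->
  tukey_map (compactD X) (prodD baireD (finD k)).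
Proof.
move=> Xn nk w1k.
have [h hinj] := (card_le_injP _ _).1 Xn; have [f finj] := (card_le_injP _ _).1 w1k.
have [g ginj] := (card_le_injP _ _).1 nk.
have [I [C [Cc Ccof tI]]] := countable_cofinal_family n.
set T := prodD baireD (finD k).
have tfin : tukey_map (finD k) T := tukey_map_snd _ _.
have T2 : tukey_map (finD I) T.
  by apply: tukey_map_trans tI _; apply: tukey_map_trans (tukey_map_fin ginj) tfin.
have T1 : tukey_map (prodD baireD (finD (aleph 1))) T.
  apply: tukey_map_prod; first exact: tukey_map_fst.
  exact: tukey_map_trans (tukey_map_fin finj) tfin.
apply: tukey_map_trans (tukey_map_prod T1 T2).
apply: tukey_bounded_compactD.
apply: tukey_bounded_sub (tukey_bounded_bigcup (fun i : I =>
  @compact_tukey_bounded baireD (h @^-1` C i) (tukey_map_pow_pow _) (tukey_map_proj _) _)).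
  move=> K cK; have [|i Ki] := Ccof (h @` K).
    exact: card_le_trans (card_image_le _ _) (compact_countable cK).
  by exists i => //; split=> // x Kx; apply: Ki; exists x.
move=> i; apply: fin_below_countable; last exact: tukey_map_proj.
exact: inj_countable_preimage.
Qed.

End upper.

(** * Lower bounds *)

Section lower.
Variables (F : archiRealFieldType) (X : topologicalType) (d : X -> X -> F).
Hypothesis dm : metrizes d.

Local Notation rad n := (n.+1%:R^-1 : F).
Local Notation W := (aleph 1).
Local Notation below := (segment (@cle (aleph 1))).

Let dxx := metrizes_xx dm.
Let dpos := metrizes_gt0 dm.
Let dC := metrizes_sym dm.
Let dtri := metrizes_tri dm.

(** A point of [K i] is in the ball of radius 1/(n+1) for n < i, and in the partial union for n >=
    i. For sets shrinking to x, this funnel is {x} together with all [K i]. *)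
Lemma funnel_partial (x : X) (K : nat -> set X) i :
  K i `<=` [set y | d x y <= rad i] ->
  K i `<=` funnel d [set x] (fun n => \bigcup_(j in `I_n.+1) K j).
Proof.
move=> Ki y Ky n; have [ni|ni] := ltnP n i; last by right; exists i.
by left; exists x => //; exact: le_trans (Ki y Ky) (rad_le F (ltnW ni)).
Qed.

Lemma funnel_partial_compact (x : X) (K : nat -> set X) :
  (forall i, compact (K i)) ->
  compact (funnel d [set x] (fun n => \bigcup_(j in `I_n.+1) K j)).
Proof.
move=> cK; apply: (funnel_compact dm) => // n.
by apply: finite_bigcup_compact => //; exact: finite_II.
Qed.

Variable P : set X.
Hypothesis Pd : dense_in_itself d P.

(** The pieces [K n] sit around points of P other than x that tend to x; with x added they form the
    compact M. The bound e keeps each piece away from x. *)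
Lemma shrinking_compacts (Q : nat -> set X -> Prop) :
  (forall n x (r : F), P x -> 0 < r ->
    exists2 K, compact K & K `<=` [set y | d x y <= r] /\ Q n K) ->
  forall x (r : F), P x -> 0 < r -> exists (M : set X) (K : nat -> set X),
    [/\ compact M, M `<=` [set y | d x y <= r] &
      forall n, [/\ K n `<=` M, Q n (K n) & exists2 e : F, 0 < e &
        forall y, K n y -> e <= d x y <= rad n] ].
Proof.
move=> hQ x r Px r0.
have /choice[K hK] : forall n, exists K, [/\ compact K, K `<=` [set y | d x y <= r],
    Q n K & exists2 e : F, 0 < e & forall y, K y -> e <= d x y <= rad n].
  (* Points within half of [d x y] of y have distance from x between 1/2 and 3/2 of [d x y], and the
     latter is below 3/4 of the minimum. *)
  move=> n; pose r' := Num.min r (rad n) / 2.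
  have m0 : 0 < Num.min r (rad n) by rewrite lt_min r0 rad_gt0.
  have [|y [Py yx xy]] := @Pd x r' Px; first by rewrite divr_gt0.
  have xy0 : 0 < d x y by apply: dpos => /esym.
  have [|K cK [Ky QK]] := hQ n y (d x y / 2) Py; first by rewrite divr_gt0.
  have hK z : K z -> d x y / 2 <= d x z <= Num.min r (rad n).
    move=> /Ky /= yz; have := dtri y x z; have := dtri z x y.
    rewrite [d z y]dC; move: xy; rewrite /r'.
    by move: (Num.min _ _) => m; move=> ? ? ?; apply/andP; split; lra.
  exists K; split=> // [z /hK/andP[_]|]; first by rewrite le_min => /andP[].
  exists (d x y / 2); first by rewrite divr_gt0.
  by move=> z /hK/andP[->]; rewrite le_min => /andP[].
exists (funnel d [set x] (fun n => \bigcup_(j in `I_n.+1) K j)), K; split.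
- by apply: funnel_partial_compact => i; have [] := hK i.
- move=> y My /=; have [n nr] := rad_small r0.
  have [[_ -> h]|[j _ Kj]] := My n; first exact: le_trans h (ltW nr).
  by have [_ + _ _] := hK j; apply.
- move=> n; have [_ _ Qn he] := hK n; split=> //.
  apply: funnel_partial => y Ky; have [e _ h] := he.
  by have /andP[] := h y Ky.
Qed.

(** For large n the piece [K n] is close to x, hence away from the points of G other than x; the
    bound e keeps it away from x itself. *)
Lemma shrinking_avoid (x : X) (K : nat -> set X) (G : set X) : finite_set G ->
  (forall n, exists2 e : F, 0 < e & forall y, K n y -> e <= d x y <= rad n) ->
  exists n m, K n `<=` ~` cnbhd d (rad m) G.
Proof.
move=> fG hK.
have /choice[f hf] : forall g, exists n, g <> x -> rad n < d x g / 3.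
  move=> g; have [->|gx] := pselect (g = x); first by exists 0%N.
  have [|n hn] := @rad_small F (d x g / 3); last by exists n.
  by rewrite divr_gt0// dpos// => /esym.
have [N hN] := @dle_ub (omegaD 0) _ (finite_image f fG).
have [e e0 he] := hK N; have [l le] := rad_small e0.
exists N, (maxn N l) => y Ky [g Gg gy].
have /andP[ey yN] := he y Ky.
have [gx|gx] := pselect (g = x).
  move: gy; rewrite gx => xy.
  have := le_trans (le_trans ey xy) (rad_le F (leq_maxr N l)).
  by rewrite leNgt le.
have fN : (f g <= N)%N by apply: hN; exists g.
have := hf g gx; have := le_trans yN (rad_le F fN).
have := le_trans gy (le_trans (rad_le F (leq_maxl N l)) (rad_le F fN)).
have := dtri y x g; rewrite [d y g]dC; move: (rad (f g)) => r.
by have := dist_ge0 dm x y; lra.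
Qed.

Lemma rank_unbounded (a : W) (x : X) (r : F) : P x -> 0 < r ->
  exists2 K, compact K & K `<=` [set y | d x y <= r] /\ ~ rank d setT a K.
Proof.
elim/(wo_ind (@cle_wo W)) : a x r => a IH.
(* First, a nonempty compact set without any rank below a: pieces without rank b, for b running
   through the countably many elements below a, shrink to x. *)
have IH' x (r : F) : P x -> 0 < r -> exists2 K, compact K & K `<=` [set y | d x y <= r] /\
    (K !=set0 /\ forall b, below a b -> ~ rank d setT b K).
  move=> Px r0; have [[b0 ab0]|nb] := pselect (exists b, below a b); last first.
    exists [set x]; first exact: compact_set1.
    split=> [_ ->|] /=; first by rewrite dxx ltW.
    by split=> [|b ab]; [exists x|exfalso; apply: nb; exists b].
  have [c cinj] := countable_inj (segment_aleph1_countable a).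
  have /choice[b bP] : forall n, exists b, below a b /\
      forall b', below a b' -> c b' = n -> b = b'.
    move=> n; have [[b [ab cb]]|h] := pselect (exists b, below a b /\ c b = n).
      by exists b; split=> // b' ab' cb'; apply: cinj => //; rewrite cb cb'.
    by exists b0; split=> // b' ab' cb'; exfalso; apply: h; exists b'.
  have [|M [K [cM Mr hK]]] :=
    @shrinking_compacts (fun n K => ~ rank d setT (b n) K) _ x r Px r0.
    by move=> n y s Py s0; apply: IH => //; have [] := bP n.
  have Mb b' : below a b' -> ~ rank d setT b' M.
    move=> ab' rM; have [KM nr _] := hK (c b').
    have [_ e] := bP (c b'); apply: nr; rewrite (e b')//.
    exact: rank_sub rM.
  exists M => //; split=> //; split=> //.
  apply/set0P/negP => /eqP M0; apply: (Mb b0 ab0).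
  by rewrite M0; exact: rank_set0.
move=> x r Px r0.
(* A sequence of such sets shrinking to x has no rank a: a neighbourhood of a finite G misses one of
   them entirely, which would then have a rank below a. Nonemptiness excludes [rank_set0]. *)
have [|M [K [cM Mr hK]]] := @shrinking_compacts (fun=> fun K => K !=set0 /\
    forall b, below a b -> ~ rank d setT b K) _ x r Px r0; first by [].
exists M => //; split=> // rM.
case: rM IH hK {IH'} => {a M cM Mr} [a|a A G b fG _ ba rb] _ hK.
  by have [K0 [[y Ky] _] _] := hK 0%N; exact: (K0 y).
have [|n [m Knm]] := @shrinking_avoid x K G fG; first by move=> n; have [] := hK n.
have [KA [_ nr] _] := hK n; apply: (nr _ (ba m)).
apply: rank_sub (rb m) => y Ky; split; first exact: KA.
exact: Knm.
Qed.

Hypothesis P0 : P !=set0.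
Hypothesis imperfect : forall A : set X, ~ homeomorphic A cantor_space.

(** Since [K (j z)] has no rank [j z], a compact L of rank b contains it only for [j z] below b,
    that is, for countably many z. *)
Lemma omega1_like_le_compactD (a : cardinal) (a0 : [set: a] !=set0) :
  (forall A : set a, countable A -> exists u, forall x, A x -> cle x u) ->
  [set: a] #<= [set: aleph 1] -> tukey_map (cardD a0) (compactD X).
Proof.
move=> bd /card_le_injP[j jinj]; have [x Px] := P0.
have /choice[K hK] : forall b, exists K, compact K /\ ~ rank d setT b K.
  by move=> b; have [K cK [_ h]] := rank_unbounded b Px ltr01; exists K.
apply: (@tukey_map_countable_fibers a a0 (compactD X) (fun z =>
  exist _ (K (j z)) (hK (j z)).1) bd) => -[L cL].
have [b rb] := compact_ranked dm imperfect cL (@subsetT _ L).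
apply: (@sub_countable _ _ _ (j @^-1` segment (@cle (aleph 1)) b)); last first.
  exact: inj_countable_preimage (segment_aleph1_countable b).
apply: subset_card_le => z /= KL; apply: contrapT => /(nsegment_le (@cle_wo W)) bz.
have [_] := hK (j z); apply; apply: rank_le bz _; exact: rank_sub KL rb.
Qed.

Lemma points_le_compactD (a : cardinal) (a0 : [set: a] !=set0) :
  (forall A : set a, countable A -> exists u, forall x, A x -> cle x u) ->
  [set: a] #<= [set: X] -> tukey_map (cardD a0) (compactD X).
Proof.
move=> bd /card_le_injP[j jinj].
apply: (@tukey_map_countable_fibers a a0 (compactD X) (fun z =>
  exist _ [set j z] (@compact_set1 X (j z))) bd) => -[L cL].
apply: (@sub_countable _ _ _ (j @^-1` L)).
  by apply: subset_card_le => z /=; apply.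
exact: inj_countable_preimage (compact_countable dm imperfect cL).
Qed.

Lemma baire_le_compactD : separable X -> tukey_map baireD (compactD X).
Proof.
move=> sX; have [p Pp] := P0.
pose Q n := P `&` [set y | d p y < rad n].
have Qd n : dense_in_itself d (Q n).
  move=> x r [Px pn] r0.
  have [|y [Py yx xy]] := @Pd x (Num.min r (rad n - d p x)) Px.
    by rewrite lt_min r0 subr_gt0.
  move: xy; rewrite lt_min => /andP[xr xn]; exists y; split=> //; split=> //=.
  by have := dtri x p y; move: xn; move: (rad n) => s; lra.
have ncl n : ~ compact (closure (Q n)).
  move=> cQ.
  have [|A] := perfect_cantor dm cQ (@subset_closure _ _) _ (@Qd n); last exact: imperfect.
  by exists p; split=> //=; rewrite dxx rad_gt0.
have clQ n : closure (Q n) `<=` [set y | d p y <= rad n].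
  move=> y Qy; apply: (@closed_dist _ _ _ dm).
  by apply: closureS Qy => z [_ /ltW].
have /choice[s hs] n := dense_sequence_gap dm sX (@closed_closure _ (Q n)) (ncl n).
pose K (f : nat -> nat) i := [set s i (f i)].
pose psi (f : nat -> nat) : compactD X := exist _ _
  (@funnel_partial_compact p (K f) (fun i => @compact_set1 X _)).
exists psi => -[L cL].
have /choice[q hq] : forall n, exists k, forall j, L (s n j) -> (j < k)%N.
  by move=> n; have [_ h] := hs n; exact: h.
exists q => f /= fL i; apply: ltnW; apply: hq; apply: fL.
apply: (@funnel_partial p (K f) i) => // _ ->.
by apply: clQ; have [] := hs i.
Qed.

Lemma card_baire_le_compactD (a : cardinal) (a0 : [set: a] !=set0) : separable X ->
  [set: a] #<= [set: aleph 1] \/ [set: a] #<= [set: X] ->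
  tukey_map (prodD (cardD a0) baireD) (compactD X).
Proof.
move=> sX h; have bX := baire_le_compactD sX; apply: tukey_map_prod => //.
have [aw|bd] := cofinality_dichotomy a0.
  apply: tukey_map_trans bX; apply: tukey_map_trans aw _; exact: tukey_map_proj.
case: h; first exact: omega1_like_le_compactD.
exact: points_le_compactD.
Qed.

End lower.

(** * Non-scattered spaces and the rationals *)

Lemma wo_wf (T : Type) (R : rel T) : wochoice.well_order R ->
  well_founded (fun y x => segment R x y).
Proof. by move=> Rwo; elim/(wo_ind Rwo) => x IH; constructor. Qed.

Lemma derivatives_exist (X : topologicalType) (W : Type) (R : rel W) :
  wochoice.well_order R -> exists D : W -> set X,
    forall a, D a = ~` \bigcup_(b in segment R a) isolated (D b).
Proof.
move=> Rwo.
pose step a (rec : forall b, segment R a b -> set X) : set X :=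
  [set x | forall b (ab : segment R a b), ~ isolated (rec b ab) x].
exists (Fix (wo_wf Rwo) (fun=> set X) step) => a.
rewrite Fix_eq => [|x f g fg]; last first.
  by congr step; apply/functional_extensionality_dep => b; apply/funext => ab.
apply/seteqP; split=> [x h [b ab]|x h b ab ix]; first exact: h.
by apply: h; exists b.
Qed.

(** The derivatives are indexed by a well-order of all subsets of X. Were none empty, choosing an
    isolated point of each would inject the power set of X into X, as a point isolated in one
    derivative is missing from all later ones. *)
Lemma scattered_of_isolated (X : topologicalType) :
  (forall A : set X, A !=set0 -> isolated A !=set0) -> scattered X.
Proof.
move=> iso; have [R Rwo] := wo_exists (set X).
have [D DE] := @derivatives_exist X _ _ Rwo.
exists (set X), R, D; split=> //; apply: contrapT => nD.
have /choice[x xP] : forall a, exists x, isolated (D a) x.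
  move=> a; apply: iso; apply/set0P/negP => /eqP D0; apply: nD.
  by exists a.
have lt a b : segment R b a -> x a <> x b.
  move=> ba e; have := isolatedS (xP b); rewrite DE; apply; exists a => //.
  by rewrite -e.
have /negP := cantor_lt X; apply; apply/card_le_injP; exists x => a b e.
apply: contrapT => ab; have [h|h] := wo_total Rwo a b.
  by apply: (lt a b).
by apply: (lt b a) => //; split=> // /esym.
Qed.

Lemma nonscattered_kernel (F : archiRealFieldType) (X : topologicalType)
    (d : X -> X -> F) : metrizes d -> ~ scattered X ->
  exists2 P, P !=set0 & dense_in_itself d P.
Proof.
move=> dm nsc; apply: contrapT => h; apply: nsc.
apply: scattered_of_isolated => A A0; apply: contrapT => niso; apply: h.
exists A => // x r Ax r0; apply: contrapT => nA; apply: niso.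
exists x; split; first by rewrite inE.
exists [set y | d x y < r]; first exact: nbhs_dist.
apply/seteqP; split=> [y [/= xy Ay]|_ ->]; last first.
  by split=> //=; rewrite (metrizes_xx dm).
by apply: contrapT => yx; apply: nA; exists y.
Qed.

Lemma metrizable_metrizes (R : realType) (X : topologicalType) :
  metrizable R X -> exists d : X -> X -> R, metrizes d.
Proof.
move=> [M [f [g [fK gK cf cg]]]]; exists (fun x y => mdist (f x) (f y)); split.
- by move=> x; exact: mdistxx.
- by move=> x y xy; rewrite mdist_gt0; apply/eqP => /(can_inj fK).
- by move=> x y; exact: metric_sym.
- by move=> y x z; exact: metric_triangle.
move=> x U; split=> [xU|[n nU]].
  have : nbhs (f x) (g @^-1` U) by apply: cg; rewrite fK.
  move=> /nbhs_ballP[e /= e0 eU]; have [n ne] := rad_small e0.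
  exists n => y yn; rewrite -(fK y); apply: eU.
  by rewrite ballEmdist /=; exact: lt_trans ne.
have := cf x _ (nbhsx_ballx (f x) _ (rad_gt0 R n)).
move=> fV; apply: (@filterS _ (nbhs x) _ _ _ _ fV) => y.
by rewrite /= ballEmdist; exact: nU.
Qed.

Section rationals.

Lemma rat_metrizes : metrizes (fun x y : rat^o => `|x - y| : rat).
Proof.
split.
- by move=> x; rewrite subrr normr0.
- by move=> x y xy; rewrite normr_gt0 subr_eq0; apply/eqP.
- by move=> x y; exact: distrC.
- by move=> y x z; exact: ler_distD.
move=> x U; split=> [/nbhs_ballP[e /= e0 eU]|[n nU]].
  have [n ne] := rad_small e0; exists n => y yn; apply: eU.
  by rewrite -ball_normE /=; exact: lt_trans ne.
apply/nbhs_ballP; exists n.+1%:R^-1 => /=; first exact: rad_gt0.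
by move=> y; rewrite -ball_normE; exact: nU.
Qed.

Lemma rat_dense_in_itself :
  dense_in_itself (fun x y : rat^o => `|x - y| : rat) setT.
Proof.
move=> x r _ r0; exists (x + r / 2); split=> //.
  by move=> /eqP; rewrite -subr_eq0 addrAC subrr add0r mulf_eq0 invr_eq0; lra.
by rewrite opprD addrA subrr add0r normrN gtr0_norm; lra.
Qed.

Lemma rat_separable : separable rat^o.
Proof. by exists setT; [exact: countableP|move=> O [x Ox] _; exists x]. Qed.

(** A homeomorphism with the Cantor space would inject the subsets of [nat] into the countable set
    of rationals. *)
Lemma rat_totally_imperfect : totally_imperfect rat^o.
Proof.
move=> A [f [g [fK gK _ _]]].
have /negP := cantor_lt nat; apply.
apply/card_le_injP.
exists (fun S : set nat => pickle (set_val (g (fun n => `[< S n >])) : rat)).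
move=> S T /(pcan_inj pickleK)/val_inj/(can_inj gK) e.
apply/funext => n; apply/propext; apply: asbool_eq_equiv.
exact: (congr1 (fun s : nat -> bool => s n) e).
Qed.

End rationals.

Section imperfect_space.
Variables (F : archiRealFieldType) (X : topologicalType) (d : X -> X -> F).
Hypotheses (dm : metrizes d) (sX : separable X) (imperfect : totally_imperfect X).
Variable P : set X.
Hypotheses (P0 : P !=set0) (Pd : dense_in_itself d P).
Local Notation kappa := (cardinal_max (aleph 1) (card_of X)).

Lemma card_le_kappa : [set: aleph 1] #<= [set: kappa] /\ [set: X] #<= [set: kappa].
Proof.
have [h1 h2] := card_le_max (aleph 1) (card_of X).
by split=> //; rewrite -(card_le_eql (card_ofE X)).
Qed.

Lemma imperfect_lower (lambda : cardinal) (l0 : [set: lambda] !=set0) :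
  [set: lambda] #<= [set: kappa] -> prodD (cardD l0) baireD <=T compactD X.
Proof.
move=> lk; apply: tukey_map_le.
apply: (card_baire_le_compactD dm Pd P0 imperfect) => //.
move: lk; rewrite /cardinal_max; case: ifP => _ lk; [right|by left].
by rewrite -(card_le_eqr (card_ofE X)).
Qed.

Lemma imperfect_bounds :
  ((forall (lambda : cardinal) (lambda0 : [set: lambda] !=set0),
      [set: lambda] #<= [set: kappa] ->
      prodD (cardD lambda0) baireD <=T compactD X) /\
   compactD X <=T powD nat (finD kappa)) /\
  (forall n : nat, [set: kappa] #= [set: aleph n] ->
     (forall m : nat, (m <= n)%N ->
        prodD (omegaD m) baireD <=T compactD X) /\
     compactD X <=T prodD baireD (finD kappa)).
Proof.
have [wk Xk] := card_le_kappa; split; first split.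
- exact: imperfect_lower.
- by apply: tukey_map_le; exact: compactD_le_fin_pow dm imperfect _ wk Xk.
move=> n kn; split=> [m mn|].
  by apply: imperfect_lower; rewrite (card_le_eqr kn); exact: aleph_le.
apply: tukey_map_le; apply: (compactD_le_baire_fin dm imperfect (n := n)) => //.
  by rewrite -(card_le_eqr kn).
by rewrite -(card_le_eql kn).
Qed.

End imperfect_space.

Local Close Scope ring_scope.

Theorem theorem15 (R : realType) :
  (forall B : topologicalType,
     separable B -> metrizable R B -> totally_imperfect B -> ~ scattered B ->
     let kappa := cardinal_max (aleph 1) (card_of B) in
     ((forall (lambda : cardinal) (lambda0 : [set: lambda] !=set0),
         [set: lambda] #<= [set: kappa] ->
         prodD (cardD lambda0) baireD <=T compactD B) /\
      compactD B <=T powD nat (finD kappa)) /\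
     (forall n : nat, [set: kappa] #= [set: aleph n] ->
        (forall m : nat, (m <= n)%N ->
           prodD (omegaD m) baireD <=T compactD B) /\
        compactD B <=T prodD baireD (finD kappa)))
  /\
  (prodD (omegaD 1) baireD <=T compactD rat^o /\
   compactD rat^o <=T prodD baireD (finD (aleph 1))).
Proof.
split=> [B sB /metrizable_metrizes[d dm] iB nsB|].
  have [P P0 Pd] := nonscattered_kernel dm nsB.
exact: (imperfect_bounds dm sB iB P0 Pd).
(* The rationals are treated through their own rational-valued metric, with [aleph 1] in place of
   kappa and n = 1. *)
split; apply: tukey_map_le.
  apply: (card_baire_le_compactD rat_metrizes rat_dense_in_itself) => //.
  - by exists 0%R.
  - exact: rat_totally_imperfect.
  - exact: rat_separable.
  - by left.
apply: (compactD_le_baire_fin rat_metrizes rat_totally_imperfect (n := 1)) => //.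
apply: card_le_trans (card_nat_aleph 1).
exact: countableP.
Qed.
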